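(* The simplicial complexes $T_{10}$ and $T_{12}$ (defined explicitly in the context) are two distinct (nonisomorphic) triangulations of $S^3$ with the following properties: (1) they are flag; (2) the corresponding Davis' manifolds $M(T_{10})$ and $M(T_{12})$ have nonzero Euler characteristic; (3) neither of them dominates any other (i.e. not isomorphic to itself) triangulation of $S^3$ that is flag and whose Davis' manifold has nonzero Euler characteristic.
   Context: A triangulation of $S^3$ is a finite simplicial complex whose geometric realization is homeomorphic to $S^3$; triangulations are considered up to simplicial isomorphism. A simplicial complex is flag if every set of pairwise adjacent vertices spans a simplex; thus a flag complex is determined by its $1$-skeleton. A triangulation $T_2$ of a sphere dominates a triangulation $T_1$ of the same sphere if there is a simplicial map $T_2\to T_1$ of nonzero degree. Davis' construction: for a finite simplicial complex $T$ with vertex set $V(T)$ (a family of subsets of $V(T)$ containing $\emptyset$ and all singletons), $M(T)$ is the cubical subcomplex of the cube $[-1,1]^{V(T)}$ consisting of all faces $\prod_{v\in V(T)} I_v$ for which there is a simplex $\sigma\in T$ (possibly empty) with $I_v=[-1,1]$ for $v\in\sigma$ and $I_v=\{-1\}$ or $\{+1\}$ for $v\notin\sigma$. If $T$ is homeomorphic to $S^{n-1}$, then $M(T)$ is a closed connected orientable $n$-manifold. $T_{10}$ is the join of two pentagons: with two disjoint $5$-cycles $P,Q$ regarded as simplicial complexes, $T_{10}=P\star Q=\{\sigma\cup\tau:\sigma\in P,\tau\in Q\}$ (10 vertices). $T_{12}$ is the flag simplicial complex with $12$ vertices $p_j$ ($j\in\mathbb{Z}/9$) and $q_i$ ($i\in\mathbb{Z}/3$)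 whose $1$-skeleton has the following $45$ edges: $p_j$ and $p_k$ are adjacent if and only if $j-k\in\{\pm1,\pm2,\pm3\}$ modulo $9$; $q_i$ and $p_j$ are adjacent if and only if $j\not\equiv i \pmod 3$; and no two of the $q_i$ are adjacent. *)

(* Defs.v *)
From HB Require Import structures.
From mathcomp Require Import all_boot all_order all_fingroup all_algebra.
From mathcomp Require Import all_classical all_reals all_analysis.

Set Implicit Arguments.
Unset Strict Implicit.
Unset Printing Implicit Defensive.

Import Order.TTheory GRing.Theory Num.Theory.
Import numFieldNormedType.Exports.

Local Open Scope classical_set_scope.
Local Open Scope ring_scope.

(* Throughout, a finite simplicial complex with vertex set V is the set T of
   its simplices, the empty one included. *)
Definition is_complex (V : finType) (T : {set {set V}}) : Prop :=
  [/\ finset.set0 \in T,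
      forall v : V, [set v]%SET \in T
    & forall s t : {set V}, s \in T -> t \subset s -> t \in T].

Definition complex_iso (V W : finType)
    (T : {set {set V}}) (U : {set {set W}}) : Prop :=
  exists2 f : V -> W, bijective f &
    forall s : {set V}, (s \in T) = ((f @: s)%SET \in U).

Definition is_flag (V : finType) (T : {set {set V}}) : Prop :=
  forall s : {set V},
    (forall x y, x \in s -> y \in s -> x != y -> [set x; y]%SET \in T) ->
    s \in T.

(* Barycentric coordinates; the coordinate of the vertex v is the one of
   index enum_rank v. *)
Definition geom_realization (R : realType) (V : finType) (T : {set {set V}}) :
    set 'rV[R]_#|V| :=
  [set x : 'rV[R]_#|V| |
    [/\ forall i, 0 <= x 0 i,
        \sum_i x 0 i = 1
      & [set v : V | x 0 (enum_rank v) != 0]%SET \in T]].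

Definition unit_sphere (R : realType) (n : nat) : set 'rV[R]_n.+1 :=
  [set x : 'rV[R]_n.+1 | \sum_i x 0 i ^+ 2 = 1].

Definition homeomorphic (X Y : topologicalType) (A : set X) (B : set Y) :
    Prop :=
  exists (f : X -> Y) (g : Y -> X),
    [/\ {within A, continuous f}, {within B, continuous g},
        forall x, A x -> B (f x) /\ g (f x) = x
      & forall y, B y -> A (g y) /\ f (g y) = y].

Definition sphere_triangulation (R : realType) (n : nat)
    (V : finType) (T : {set {set V}}) : Prop :=
  is_complex T /\
  homeomorphic (@geom_realization R V T) (@unit_sphere R n).

(* Oriented simplicial chains with integer coefficients, in degree k - 1: the
   value c t is the coefficient of the simplex with vertices t_0, ..., t_(k-1)
   oriented by this order, so that c is alternating.  For k = 0 the empty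
   simplex is allowed, so that the homology below is reduced homology. *)
Definition is_chain (V : finType) (T : {set {set V}}) (k : nat)
    (c : {ffun k.-tuple V -> int}) : Prop :=
  (forall (t : k.-tuple V) (p : 'S_k),
     c [tuple tnth t (p i) | i < k] = (-1) ^+ p * c t) /\
  (forall t : k.-tuple V, c t != 0 -> uniq t /\ [set x in t]%SET \in T).

(* The usual boundary sum_i (-1)^i [.., omitting t_i, ..], in coordinates: the
   oriented simplices with [t] in their boundary with sign +1 are the (v, t). *)
Definition boundary (V : finType) (k : nat)
    (c : {ffun k.+1.-tuple V -> int}) : {ffun k.-tuple V -> int} :=
  [ffun t : k.-tuple V => \sum_(v : V) c [tuple of v :: t]].

(* On alternating functions, the simplices collapsed by f contribute 0. *)
Definition chain_map (V W : finType) (f : V -> W) (k : nat)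
    (c : {ffun k.-tuple V -> int}) : {ffun k.-tuple W -> int} :=
  [ffun t : k.-tuple W =>
     \sum_(s : k.-tuple V | [tuple of map f s] == t) c s].

Definition is_cycle (V : finType) (T : {set {set V}}) (n : nat)
    (z : {ffun n.+1.-tuple V -> int}) : Prop :=
  is_chain T z /\ boundary z = 0.

Definition homologous (V : finType) (T : {set {set V}}) (k : nat)
    (z z' : {ffun k.-tuple V -> int}) : Prop :=
  exists2 w : {ffun k.+1.-tuple V -> int}, is_chain T w & z - z' = boundary w.

(* The n-th homology group is infinite cyclic, generated by the class of z. *)
Definition fundamental_cycle (V : finType) (T : {set {set V}}) (n : nat)
    (z : {ffun n.+1.-tuple V -> int}) : Prop :=
  is_cycle T z /\
  forall c, is_cycle T c -> exists! m : int, homologous T c (z *~ m).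

Definition simplicial_map (V W : finType)
    (T : {set {set V}}) (U : {set {set W}}) (f : V -> W) : Prop :=
  forall s : {set V}, s \in T -> (f @: s)%SET \in U.

(* The degree of f depends on the choice of the orientations only up to sign. *)
Definition has_degree (V W : finType) (T : {set {set V}}) (U : {set {set W}})
    (n : nat) (f : V -> W) (d : int) : Prop :=
  exists (z : {ffun n.+1.-tuple V -> int}) (z' : {ffun n.+1.-tuple W -> int}),
    [/\ fundamental_cycle T z, fundamental_cycle U z'
      & homologous U (chain_map f z) (z' *~ d)].

Definition dominates (n : nat) (V W : finType)
    (T : {set {set V}}) (U : {set {set W}}) : Prop :=
  exists f : V -> W, simplicial_map T U f /\
    exists2 d : int, d != 0 & has_degree T U n f d.

(* The face \prod_v I_v of the cube [-1, 1]^V is encoded by c, where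
   I_v = [-1, 1] if c v = None, {+1} if c v = Some true, and {-1} if
   c v = Some false. *)
Definition cube_face (V : finType) := {ffun V -> option bool}.

Definition cube_face_dim (V : finType) (c : cube_face V) : nat :=
  #|[set v | c v == None]%SET|.

Definition davis_manifold (V : finType) (T : {set {set V}}) :
    {set cube_face V} :=
  [set c : cube_face V |
    [exists s in T, [forall v, (c v == None) == (v \in s)]]]%SET.

Definition euler_char (V : finType) (M : {set cube_face V}) : int :=
  \sum_(c in M) (-1) ^+ cube_face_dim c.

Definition simplicial_join (V W : finType) (P : {set {set V}}) (Q : {set {set W}}) :
    {set {set V + W}} :=
  [set (@inl V W @: s :|: @inr V W @: t) | s : {set V} in P,
                                           t : {set W} in Q]%SET.

Definition pentagon : {set {set 'Z_5}} :=
  [set s : {set 'Z_5} | [exists i : 'Z_5, s \subset [set i; i + 1]]]%SET.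

Definition T10 : {set {set 'Z_5 + 'Z_5}} := simplicial_join pentagon pentagon.

Definition flag_complex (V : finType) (e : rel V) : {set {set V}} :=
  [set s : {set V} |
    [forall x in s, forall y in s, (x != y) ==> e x y]]%SET.

(* inl j is p_j and inr i is q_i. *)
Definition T12_adj : rel ('Z_9 + 'Z_3) := fun x y =>
  match x, y with
  | inl j, inl k => j - k \in [:: 1; -1; 2; -2; 3; -3]
  | inl j, inr i => ((j : nat) != i %[mod 3])%N
  | inr i, inl j => ((j : nat) != i %[mod 3])%N
  | inr _, inr _ => false
  end.

Definition T12 : {set {set 'Z_9 + 'Z_3}} := flag_complex T12_adj.

(* Main.v *)
Require Import Defs.
From mathcomp Require Import all_boot all_order all_fingroup all_algebra.
From mathcomp Require Import all_classical all_reals all_analysis.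
From mathcomp Require Import zify ring lra.

(* The complexes T10 and T12 are the boundary complexes of simplicial 4-polytopes with
   small integer vertices, so radial projection identifies them with the 3-sphere.

   Let T be a triangulated 3-sphere and f : T_i -> T a map of nonzero degree.  No nonzero
   multiple of the image c of the fundamental cycle is a boundary in T.  If the support
   of c missed a simplex s, it would lie in the complement of the barycenter of s, which
   is contractible inside |T|; subdividing c, moving it by small steps along a
   contraction, and replacing each point by a vertex with a large barycentric coordinate,
   one would get a chain with boundary 4! c.  Hence every simplex of T lies in the
   support of c.  So T has dimension 3, each of its triangles lies in at least two
   tetrahedra, its graph is a quotient of the graph of T_i, and, T being flag, it has at
   least 8 vertices: those of a tetrahedron and the four apexes opposite to them.  An
   exhaustive search shows that 16 - 8 f_0 + 4 f_1 - 2 f_2 + f_3 vanishes for every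
   proper quotient with these properties; this is the Euler characteristic of the Davis
   manifold up to a power of 2. *)

(** That no nonzero multiple of the image cycle bounds comes from the definition of
    [fundamental_cycle], whose uniqueness clause gives the class infinite order. The obstacle is
    that the filling must be a simplicial chain of T, while the contraction of a punctured sphere is
    only continuous. The contraction is therefore sampled at finitely many times and points, and
    each sample is replaced by a vertex of the simplex carrying it; Sperner's lemma says that at
    time 0 this returns the original chain. The factor 4! appears because chains are functions of
    ordered simplices, and a sum over tuples meets each simplex once for every order of its
    vertices.

    A set of 12 vertices has more than four million partitions, so partial quotients must be
    discarded early. Blocks are never merged and edges are never removed afterwards: a 5-clique
    persists, and each remaining vertex adds at most one block. A surviving map is injective on
    vertices, and it is then an isomorphism because each simplex of T lies in the image of a simplex
    of T_i. *)

Set Implicit Arguments.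
Unset Strict Implicit.
Unset Printing Implicit Defensive.

Import Order.TTheory GRing.Theory Num.Theory.
Import numFieldNormedType.Exports.


(** * Exhaustive search over the quotients of a graph *)

(* Conditionals instead of [||] and [&&]: vm_compute is call-by-value and would
   evaluate both arguments. *)
Fixpoint has_clique (adj : nat -> nat -> bool) (k : nat) (S : seq nat) : bool :=
  if k is k'.+1 then
    (fix loop S := if S is v :: S' then
      if has_clique adj k' [seq x <- S' | adj v x] then true else loop S' else false) S
  else true.

Fixpoint mem_nat (x : nat) (s : seq nat) : bool :=
  if s is y :: s' then if eqn x y then true else mem_nat x s' else false.

Definition link (t : seq (seq nat)) (x y : nat) := mem_nat y (nth [::] t x).

Definition add_edge (b c : nat) (t : seq (seq nat)) :=
  if eqn b c then t else if link t b c then t else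
  set_nth [::] (set_nth [::] t b (c :: nth [::] t b)) c (b :: nth [::] t c).

Fixpoint cliques (T : Type) (adj : T -> T -> bool) (S : seq T) : seq (seq T) :=
  if S is v :: S' then
    let C := cliques adj S' in C ++ [seq v :: c | c <- C & all (adj v) c]
  else [:: [::]].

(* Up to a power of 2, [16 + 4 f_1 + f_3 - (8 f_0 + 2 f_2)] is the Euler characteristic
   of Davis' manifold; [f k] counts the simplices with [k] vertices. *)
Definition leaf_ok (t : seq (seq nat)) : bool :=
  let m := size t in
  let C := cliques (link t) (iota 0 m) in
  let f k := count (fun c => eqn (size c) k) C in
  if eqn (16 + 4 * f 2 + f 4) (8 * m + 2 * f 3) then true else
  has (fun c => if eqn (size c) 3 then count (fun v => all (link t v) c) (iota 0 m) < 2
                else false) C.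

(* The vertices are distributed one by one into blocks: [a] lists the blocks of the
   vertices treated so far, [t] the neighbours of each block in the quotient graph,
   [back] the earlier neighbours of each remaining vertex.  The bound 8 and the
   exclusion of 5-cliques hold in every flag 3-manifold. *)
Fixpoint search (n : nat) (back : seq (seq nat)) (a : seq nat) (t : seq (seq nat)) : bool :=
  if back is js :: back' then
    all (fun b =>
      let t' := foldr (fun j t => add_edge b (nth 0 a j) t)
                  (if eqn b (size t) then rcons t [::] else t) js in
      if size t' + size back' < 8 then true else
      if has_clique (link t') 4 (nth [::] t' b) then true else
      search n back' (rcons a b) t') (iota 0 (size t).+1)
  else if eqn (size t) n then true else leaf_ok t.


Definition backs (adj : nat -> nat -> bool) n :=
  [seq [seq j <- iota 0 i | adj i j] | i <- iota 0 n].

Lemma mem_natE x s : mem_nat x s = (x \in s).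
Proof. by elim: s => //= y s ->; rewrite inE -[eqn x y]/(x == y); case: (x == y). Qed.

Lemma mem_cliques (T : eqType) (adj : rel T) S c :
  (c \in cliques adj S) = subseq c S && pairwise adj c.
Proof.
elim: S c => [|v S IHS] c.
  by rewrite inE subseq0; case: eqP => [->|].
rewrite /= mem_cat IHS; apply/orP/andP => [[/andP[cS cc]|/mapP[d]]|[]].
- by split=> //; apply: subseq_trans cS (subseq_cons _ _).
- by rewrite mem_filter IHS => /and3P[vd dS dd] ->; rewrite /= eqxx dS vd.
- case: c => [|x c]; first by rewrite sub0seq; left.
  rewrite [subseq _ _]/=; case: eqP => [->|_] /= cS; last by move=> ->; rewrite cS; left.
  move=> /andP[vc cc]; right; apply: map_f.
  by rewrite mem_filter vc IHS cS.
Qed.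

Lemma uniq_cliques (T : eqType) (adj : rel T) S : uniq S -> uniq (cliques adj S).
Proof.
elim: S => //= v S IHS /andP[vS /IHS uC]; rewrite cat_uniq uC /=.
rewrite map_inj_uniq; last by move=> c d [].
rewrite filter_uniq // andbT; apply/hasPn => _ /mapP[c _ ->].
rewrite mem_cliques negb_and; apply/orP; left; apply: contra vS => /mem_subseq; apply.
exact: mem_head.
Qed.

(** This transfers clique counts computed on natural numbers to the vertices of a complex. *)
Lemma cliques_map (T : eqType) (U : Type) (adj : rel T) (adj' : rel U) (h : T -> U) S :
  {in S &, forall x y, adj' (h x) (h y) = adj x y} ->
  cliques adj' (map h S) = map (map h) (cliques adj S).
Proof.
elim: S => //= v S IHS hE; rewrite map_cat IHS; last first.
  by move=> x y xS yS; apply: hE; rewrite inE ?xS ?yS orbT.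
congr (_ ++ _); rewrite filter_map -!map_comp.
rewrite (@eq_in_filter _ _ (fun c => all (adj v) c)) // => c.
rewrite mem_cliques /= all_map => /andP[cS _]; apply: eq_in_all => x xc /=.
by rewrite hE ?mem_head // inE (mem_subseq cS xc) orbT.
Qed.

Lemma has_cliqueP adj k S : has_clique adj k S ->
  exists c, [/\ size c = k, subseq c S & pairwise adj c].
Proof.
elim: k S => [|k IHk] S; first by exists [::]; rewrite sub0seq.
elim: S => //= v S IHS; case: ifP => [/IHk[c [sc cS cc]] _|_ /IHS[c [sc cS cc]]].
  exists (v :: c); split; rewrite /= ?sc // ?eqxx.
    exact: subseq_trans cS (filter_subseq _ _).
  rewrite cc andbT; apply/allP => x /(mem_subseq cS).
  by rewrite mem_filter => /andP[].
exists c; split=> //; exact: subseq_trans cS (subseq_cons _ _).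
Qed.

Definition symm (t : seq (seq nat)) := forall x y, link t x y = link t y x.

Lemma size_add_edge b c t : b < size t -> c < size t -> size (add_edge b c t) = size t.
Proof.
move=> bt ct; rewrite /add_edge; case: ifP => // _; case: ifP => // _.
by rewrite !size_set_nth (maxn_idPr bt) (maxn_idPr ct).
Qed.

Lemma link_add_edge b c t x y : symm t -> b != c ->
  link (add_edge b c t) x y =
  [|| link t x y, (x == b) && (y == c) | (x == c) && (y == b)].
Proof.
move=> st bc; rewrite /add_edge -[eqn b c]/(b == c) (negPf bc).
case: ifP => [bct|_].
  apply/idP/or3P => [->|[//|/andP[/eqP-> /eqP->]//|/andP[/eqP-> /eqP->]]]; first by constructor.
  by rewrite st.
rewrite /link !nth_set_nth /= !nth_set_nth /=.
have cb : (c == b) = false by rewrite eq_sym (negPf bc).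
case: (eqVneq x c) => [->|xc]; rewrite ?eqxx ?cb /=.
  by rewrite -[eqn y b]/(y == b); case: (y == b); rewrite ?orbT ?orbF.
case: (eqVneq x b) => [->|xb]; rewrite ?eqxx ?orbF //=.
by rewrite -[eqn y c]/(y == c); case: (y == c); rewrite ?orbT ?orbF.
Qed.

Lemma add_edge_id b t : add_edge b b t = t.
Proof. by rewrite /add_edge -[eqn b b]/(b == b) eqxx. Qed.

Lemma symm_add_edge b c t : symm t -> symm (add_edge b c t).
Proof.
move=> st; have [->|bc] := eqVneq b c; first by rewrite add_edge_id.
move=> x y; rewrite !link_add_edge // st; congr (_ || _).
by rewrite orbC; congr (_ || _); rewrite andbC.
Qed.

(** * Soundness of the search *)

Section Soundness.
Variables (V : finType) (g : rel V) (n : nat) (adj : rel nat) (f : nat -> V) (v0 : V).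
Hypothesis gS : symmetric g.
Hypothesis gI : irreflexive g.
Hypothesis adjS : forall i j, i < n -> j < n -> adj i j = adj j i.
Hypothesis hom : forall i j, i < n -> j < n -> adj i j -> f i != f j -> g (f i) (f j).
Hypothesis onto : forall u v, g u v -> exists i j,
  [/\ i < n, j < n, adj i j, f i = u & f j = v].
Hypothesis surj : forall v, exists2 i, i < n & f i = v.
Hypothesis noK5 : forall c : seq V, size c = 5 -> ~~ pairwise g c.
Hypothesis card8 : 8 <= #|V|.

Definition nclique (S : seq V) k := count (fun c => size c == k) (cliques g S).

(** The enumeration [S] is arbitrary because the one built by the search, which orders the points by
    blocks, is known only at a leaf. *)
Hypothesis euler : forall S : seq V, uniq S -> (forall v, v \in S) ->
  16 + 4 * nclique S 2 + nclique S 4 != 8 * size S + 2 * nclique S 3.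
Hypothesis pseudo : forall (S c : seq V), uniq S -> (forall v, v \in S) ->
  pairwise g c -> size c = 3 -> 1 < count (fun v => all (g v) c) S.

(** While vertices are being placed, recorded links are true adjacencies, which is what discarding
    5-cliques relies on. The converse holds once all vertices are placed, by [onto]. *)
Definition sound_table (t : seq (seq nat)) (rep : seq V) :=
  [/\ size t = size rep, symm t &
    forall x y, link t x y ->
      [/\ x < size rep, y < size rep & g (nth v0 rep x) (nth v0 rep y)]].

Lemma sound_add_edge b c t rep : sound_table t rep -> b < size rep -> c < size rep ->
  (b != c -> g (nth v0 rep b) (nth v0 rep c)) ->
  sound_table (add_edge b c t) rep.
Proof.
move=> [st sy t1] bm cm gbc; have [->|bc] := eqVneq b c; first by rewrite add_edge_id.
split; [by rewrite size_add_edge ?st|exact: symm_add_edge|move=> x y].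
rewrite link_add_edge // => /or3P[/t1//|/andP[/eqP-> /eqP->]|/andP[/eqP-> /eqP->]].
  by split=> //; exact: gbc.
by split=> //; rewrite gS; exact: gbc.
Qed.

(** [rep] names the point of [V] represented by each block: this is the invariant of the branch of
    the search whose blocks are the fibres of [f]. *)
Definition state (a : seq nat) (t : seq (seq nat)) (rep : seq V) :=
  [/\ uniq rep, sound_table t rep,
    forall i, i < size a -> nth 0 a i < size rep /\ nth v0 rep (nth 0 a i) = f i &
    forall i j, i < size a -> j < size a -> adj i j -> nth 0 a i != nth 0 a j ->
      link t (nth 0 a i) (nth 0 a j)].

Definition insert_edges (a : seq nat) b t js :=
  foldr (fun j t => add_edge b (nth 0 a j) t) t js.

Lemma insert_edgesP a b t js rep : sound_table t rep -> b < size rep ->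
  (forall j, j \in js -> nth 0 a j < size rep /\
    (b != nth 0 a j -> g (nth v0 rep b) (nth v0 rep (nth 0 a j)))) ->
  [/\ sound_table (insert_edges a b t js) rep,
    forall x y, link t x y -> link (insert_edges a b t js) x y &
    forall j, j \in js -> b != nth 0 a j -> link (insert_edges a b t js) b (nth 0 a j)].
Proof.
move=> st bm; elim: js => [|j js IHjs] jP; first by split.
have [|s1 mono new] := IHjs; first by move=> i ij; apply: jP; rewrite inE ij orbT.
have [jm gj] := jP j (mem_head _ _).
have [_ sy _] := s1.
split=> /= [|x y /mono l1|i]; first exact: sound_add_edge.
  have [E|bj] := eqVneq b (nth 0 a j); first by rewrite -E add_edge_id.
  by rewrite link_add_edge // l1.
rewrite inE => /predU1P[->|/new{}new] bi; first by rewrite link_add_edge // !eqxx orbT.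
have [E|bj] := eqVneq b (nth 0 a j); first by rewrite -E add_edge_id new.
by rewrite link_add_edge // new.
Qed.

(** Each vertex still to be placed brings at most one new point. Compared with [card8], this
    excludes the branches cut by the size test. *)
Lemma card_le_rep (rep : seq V) k : (forall i, i < k -> f i \in rep) ->
  k <= n -> #|V| <= size rep + (n - k).
Proof.
move=> frep kn; rewrite cardE -(size_iota k (n - k)) -(size_map f) -size_cat.
apply: uniq_leq_size (enum_uniq _) _ => v _.
have [i ni <-] := surj v; rewrite mem_cat; have [/frep->//|ki] := ltnP i k.
by rewrite map_f ?orbT // mem_iota ki subnKC.
Qed.

(** At a leaf the table is the whole graph [g], so the counts made by [leaf_ok] are the true ones,
    and [euler] and [pseudo] exclude its two reasons for accepting. *)
Lemma leaf_sound t rep : uniq rep -> sound_table t rep -> (forall v, v \in rep) ->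
  (forall x y, x < size rep -> y < size rep -> g (nth v0 rep x) (nth v0 rep y) -> link t x y) ->
  ~~ leaf_ok t.
Proof.
move=> ur [st sy t1] allr t2.
have gE : {in iota 0 (size t) &, forall x y, g (nth v0 rep x) (nth v0 rep y) = link t x y}.
  move=> x y; rewrite !mem_iota /= !add0n st => xm ym.
  by apply/idP/idP => [|/t1[]//]; apply: t2.
have rE : rep = map (nth v0 rep) (iota 0 (size t)) by rewrite st map_nth_iota0 ?take_size.
have cE := cliques_map gE; rewrite -rE in cE.
have fE k : count (fun c => eqn (size c) k) (cliques (link t) (iota 0 (size t))) = nclique rep k.
  by rewrite /nclique cE count_map; apply: eq_count => c /=; rewrite size_map.
rewrite /leaf_ok; rewrite !fE.
have := euler ur allr; rewrite -st => /negPf; rewrite -[eqn _ _]/(_ == _ :> nat) => ->.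
apply/hasPn => c; rewrite mem_cliques => /andP[cS cc].
rewrite -[eqn _ _]/(_ == _ :> nat); case: eqP => // c3.
rewrite -leqNgt.
have cm : {subset c <= iota 0 (size t)} by exact: mem_subseq.
have : 1 < count (fun v => all (g v) (map (nth v0 rep) c)) rep.
  apply: pseudo; rewrite ?size_map // pairwise_map.
  by apply: sub_pairwise cc => x y /t1[].
rewrite [X in count _ X]rE count_map => gc; apply: leq_trans gc _.
rewrite leq_eqVlt; apply/orP; left; apply/eqP/eq_in_count => v vm /=.
by rewrite all_map; apply: eq_in_all => x /cm xm /=; rewrite gE.
Qed.

Lemma searchS js back a t : search n (js :: back) a t =
  all (fun b =>
    let t' := insert_edges a b (if eqn b (size t) then rcons t [::] else t) js in
    if size t' + size back < 8 then true else
    if has_clique (link t') 4 (nth [::] t' b) then true else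
    search n back (rcons a b) t') (iota 0 (size t).+1).
Proof. by []. Qed.

(** One branch of the search follows the fibres of [f]. It is never cut, by [card8] and [noK5], and
    its leaf is not accepted by [leaf_ok]; so the value true forces n blocks, that is, the n images
    are distinct. *)
Lemma search_sound back a t rep : state a t rep -> size a <= n ->
  back = drop (size a) (backs adj n) -> search n back a t ->
  uniq (map f (iota 0 n)).
Proof.
elim: back a t rep => [|js back IHback] a t rep [ur [st sy t1] aP a2] an backE.
  rewrite /=.
  have {an backE} an : size a = n.
    apply/eqP; rewrite eqn_leq an /=; have := congr1 size backE.
    by rewrite size_drop size_map size_iota /= => /esym/eqP; rewrite subn_eq0.
  have allr v : v \in rep.
    have [i ni <-] := surj v; rewrite -an in ni; have [am <-] := aP i ni.
    exact: mem_nth.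
  rewrite -[eqn _ _]/(_ == _ :> nat); case: eqP => [tn _|_ leaf]; last first.
    suff t2 x y : x < size rep -> y < size rep -> g (nth v0 rep x) (nth v0 rep y) ->
        link t x y.
      by have := leaf_sound ur (And3 st sy t1) allr t2; rewrite leaf.
    move=> xm ym gxy.
    have [i [j [ni nj ij fi fj]]] := onto gxy; rewrite -an in ni nj.
    have [[ai ei] [aj ej]] := (aP i ni, aP j nj).
    have {fi} fi : nth 0 a i = x by apply/eqP; rewrite -(nth_uniq v0 _ _ ur) // ei fi.
    have {fj} fj : nth 0 a j = y by apply/eqP; rewrite -(nth_uniq v0 _ _ ur) // ej fj.
    rewrite -fi -fj; apply: a2 => //; rewrite fi fj; apply: contraTneq gxy => ->.
    by rewrite gI.
  apply: (leq_size_uniq ur); last by rewrite size_map size_iota -st tn.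
  move=> v _; have [i ni <-] := surj v; by rewrite map_f // mem_iota.
set k := size a in an backE *.
have kn : k < n.
  rewrite ltnNge; apply/negP => nk; move: backE; rewrite drop_oversize //.
  by rewrite size_map size_iota.
have [jsE backE'] : js = [seq j <- iota 0 k | adj k j] /\ back = drop k.+1 (backs adj n).
  move: backE; rewrite (drop_nth [::]); last by rewrite size_map size_iota.
  by rewrite (nth_map 0) ?size_iota // nth_iota // => -[].
(* When [f k] is new, [index] returns [size rep], which is exactly the number of the fresh block. *)
pose b := index (f k) rep.
have bm : b <= size rep by exact: index_size.
have st0 : sound_table t rep by split.
pose rep' := if b == size rep then rcons rep (f k) else rep.
have sr' : size rep <= size rep' by rewrite /rep'; case: ifP; rewrite ?size_rcons.
have nr' x : x < size rep -> nth v0 rep' x = nth v0 rep x.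
  by move=> xm; rewrite /rep'; case: ifP => // _; rewrite nth_rcons xm.
have br' : b < size rep'.
  by rewrite /rep'; case: eqP => [->|/eqP bn]; rewrite ?size_rcons // ltn_neqAle bn.
have fk : nth v0 rep' b = f k.
  rewrite /rep'; case: eqP => [->|/eqP bn]; first by rewrite nth_rcons ltnn eqxx.
  by rewrite nth_index // -index_mem ltn_neqAle bn.
have ur' : uniq rep'.
  rewrite /rep'; case: eqP => // bn; rewrite rcons_uniq ur andbT.
  by rewrite -index_mem -/b bn ltnn.
pose t0 := if eqn b (size t) then rcons t [::] else t.
have lt0 x y : link t0 x y = link t x y.
  rewrite /t0; case: ifP => // _; rewrite /link nth_rcons; case: ltnP => // xm.
  by rewrite [nth _ t _]nth_default //; case: ifP.
have st0' : sound_table t0 rep'.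
  split=> [|x y|x y]; rewrite ?lt0 //.
    by rewrite /t0 /rep' -[eqn _ _]/(_ == _ :> nat) st; case: ifP; rewrite ?size_rcons st.
  by move=> /t1[xm ym gxy]; rewrite !nr' // !(leq_trans _ sr').
have jsP j : j \in js -> nth 0 a j < size rep' /\
    (b != nth 0 a j -> g (nth v0 rep' b) (nth v0 rep' (nth 0 a j))).
  rewrite jsE mem_filter mem_iota /= add0n => /andP[kj jk].
  have [am ej] := aP j jk; split=> [|bj]; first exact: leq_trans am sr'.
  rewrite fk nr' // ej; apply: hom => //; first exact: ltn_trans jk kn.
  by rewrite -fk -ej -nr' // nth_uniq // (leq_trans am sr').
have [st' mono new] := insert_edgesP st0' br' jsP.
rewrite searchS => /allP/(_ b); rewrite mem_iota add0n ltnS st => /(_ bm).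
cbv beta zeta; rewrite -st -/t0; set t' := insert_edges _ _ _ _ in st' mono new *.
have [sst' sy' t1'] := st'.
have repf i : i < k.+1 -> f i \in rep'.
  rewrite ltnS leq_eqVlt => /predU1P[->|ik]; first by rewrite -fk mem_nth.
  by have [am <-] := aP i ik; rewrite -nr' // mem_nth // (leq_trans am sr').
case: ifP => [small _|_].
  have := card_le_rep repf kn; rewrite backE' size_drop size_map size_iota sst' in small.
  by move/(leq_trans card8); rewrite leqNgt small.
(* The block b and four pairwise linked neighbours of it would be a 5-clique of [g]. *)
case: ifP => [/has_cliqueP[c [sc cS cc]] _|_].
  have /noK5/negP[] : size (map (nth v0 rep') (b :: c)) = 5 by rewrite size_map /= sc.
  rewrite pairwise_map /= (sub_pairwise _ cc) => [|x y /t1'[]//]; rewrite andbT.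
  apply/allP => x /(mem_subseq cS); rewrite -mem_natE => bx.
  by have [] := t1' b x bx.
apply: (IHback _ _ rep'); rewrite ?size_rcons //.
  split=> //; rewrite size_rcons => i.
    rewrite ltnS leq_eqVlt nth_rcons => /predU1P[->|ik]; first by rewrite ltnn eqxx.
    by rewrite ik; have [am ei] := aP i ik; rewrite nr' // (leq_trans am sr').
  move=> j; rewrite !ltnS !nth_rcons.
  have newE j' : j' < k -> adj k j' -> b != nth 0 a j' -> link t' b (nth 0 a j').
    by move=> jk kj; apply: new; rewrite jsE mem_filter kj mem_iota.
  rewrite leq_eqVlt => /predU1P[->|ik]; rewrite leq_eqVlt => /predU1P[->|jk].
  - by rewrite ltnn eqxx.
  - by rewrite ltnn eqxx jk; exact: newE.
  - by rewrite ltnn eqxx ik sy' eq_sym (adjS (ltn_trans ik kn) kn); exact: newE.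
  - by rewrite ik jk => ij aij; apply: mono; rewrite lt0; exact: a2.
Qed.

Lemma exhaustive_search : search n (backs adj n) [::] [::] -> uniq (map f (iota 0 n)).
Proof.
apply: (@search_sound _ _ _ [::]); rewrite ?drop0 //; split=> //; split=> // x y;
by rewrite /link !nth_nil.
Qed.

End Soundness.

Local Open Scope ring_scope.

(** * Euler characteristic of Davis' manifold *)

(** Faces are sorted by their set of free coordinates, which must be a simplex s. There are 2^(#|V|
    - #|s|) faces for each s, one for every choice of signs outside s, all of dimension #|s|. *)
Lemma euler_char_davis (V : finType) (T : {set {set V}}) :
  euler_char (davis_manifold T) = \sum_(s in T) (-1) ^+ #|s| * 2 ^+ (#|V| - #|s|).
Proof.
pose free (c : cube_face V) := [set v | c v == None].
have davisE (c : cube_face V) : (c \in davis_manifold T) = (free c \in T).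
  rewrite inE; apply/exists_inP/idP => [[s sT /forallP sc]|cT].
    rewrite (_ : free c = s) //; apply/setP => v; rewrite inE; by move: (sc v) => /eqP.
  by exists (free c) => //; apply/forallP => v; rewrite inE.
rewrite /euler_char (partition_big free (mem T)) /= => [|c]; last by rewrite davisE.
apply: eq_bigr => s sT.
rewrite (eq_big (fun c => c \in pffun_on None (~: s) (predC1 None)) (fun=> (-1) ^+ #|s|)).
- have sC : #|~: s| = (#|V| - #|s|)%N by rewrite cardsCs finset.setCK.
  rewrite sumr_const card_pffun_on cardC1 card_option card_bool sC.
  by rewrite -[LHS]mulr_natr natrX.
- move=> c; rewrite davisE; apply/andP/pffun_onP => [[_ /eqP <-]|[cs cR]].
    split=> [|y /fintype.imageP[v]]; last by rewrite !inE => vc ->.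
    by apply/fintype.subsetP => v; rewrite !inE.
  have E : free c = s.
    apply/setP => v; rewrite inE; apply/idP/idP => [cv|].
      apply: contraTT cv => vs; have : c v \in predC1 None.
        by apply: cR; apply: fintype.image_f; rewrite inE.
      by rewrite inE.
    apply: contraTT => cv; have := fintype.subsetP cs v; rewrite !inE; exact.
  by rewrite E sT.
- by move=> c /andP[_ /eqP <-].
Qed.

(** * Simplices of a flag complex as cliques of its graph *)

Section Flag.
Variables (V : finType) (T : {set {set V}}).
Hypotheses (Tc : is_complex T) (Tf : is_flag T).

Definition adjacent : rel V := fun x y => (x != y) && ([set x; y] \in T).

Lemma adjacent_sym : symmetric adjacent.
Proof. by move=> x y; rewrite /adjacent eq_sym finset.setUC. Qed.

Lemma adjacent_irr : irreflexive adjacent.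
Proof. by move=> x; rewrite /adjacent eqxx. Qed.

Lemma flagE (s : {set V}) :
  (s \in T) = [forall x in s, forall y in s, (x != y) ==> adjacent x y].
Proof.
have [_ _ Tsub] := Tc.
apply/idP/forall_inP => [sT x xs|sP].
  apply/forall_inP => y ys; apply/implyP => xy; rewrite /adjacent xy.
  by apply: Tsub sT _; rewrite finset.subUset !finset.sub1set xs ys.
apply: Tf => x y xs ys xy.
by have /forall_inP/(_ y ys)/implyP/(_ xy)/andP[] := sP x xs.
Qed.

Lemma pairwise_set (c : seq V) : pairwise adjacent c = uniq c && ([set x in c] \in T).
Proof.
apply/idP/andP => [cc|[uc]].
  split.
    rewrite uniq_pairwise; apply: sub_pairwise cc => x y /=.
    by case/andP.
  rewrite flagE; apply/forall_inP => x; rewrite inE => xc.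
  apply/forall_inP => y; rewrite inE => yc; apply/implyP => xy.
  elim: c cc xc yc => //= v c IHc /andP[/allP vc cc]; rewrite !inE.
  move=> /predU1P[xv|xc] /predU1P[yv|yc].
  - by rewrite xv yv eqxx in xy.
  - by rewrite xv vc.
  - by rewrite yv adjacent_sym vc.
  - exact: IHc.
rewrite flagE => /forall_inP cT.
have {}cT x y : x \in c -> y \in c -> x != y -> adjacent x y.
  move=> xc yc; apply/implyP; have xc' : x \in [set x in c] by rewrite inE.
  by have /forall_inP := cT x xc'; apply; rewrite inE.
elim: c uc cT => //= v c IHc /andP[vc uc] cT; apply/andP; split.
  apply/allP => x xc; apply: cT; rewrite ?mem_head // ?inE ?xc ?orbT //.
  by apply: contraNneq vc => ->.
by apply: IHc => // x y xc yc; apply: cT; rewrite inE ?xc ?yc orbT.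
Qed.

Variable S : seq V.
Hypotheses (Su : uniq S) (Sall : forall v, v \in S).

(** A simplex has exactly one listing in the order of [S], and by flagness the listings that occur
    are the cliques. *)
Lemma perm_cliques : perm_eq [seq [set x in c] | c <- cliques adjacent S] (enum T).
Proof.
apply: uniq_perm (enum_uniq _) _.
  rewrite map_inj_in_uniq ?uniq_cliques // => c d.
  rewrite !mem_cliques => /andP[/(subseq_uniqP Su) cE _] /andP[/(subseq_uniqP Su) dE _] E.
  rewrite cE dE; apply: eq_filter => x.
  by have /setP/(_ x) := E; rewrite !inE.
move=> s; rewrite mem_enum; apply/mapP/idP => [[c]|sT].
  by rewrite mem_cliques pairwise_set => /and3P[_ _ cT] ->.
have E : s = [set x in [seq x <- S | x \in s]].
  by apply/setP => x; rewrite inE mem_filter Sall andbT.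
exists ([seq x <- S | x \in s]) => //.
by rewrite mem_cliques filter_subseq pairwise_set filter_uniq // -E.
Qed.

Lemma sum_cliques (F : nat -> int) :
  \sum_(s in T) F #|s| = \sum_(c <- cliques adjacent S) F (size c).
Proof.
rewrite -big_enum -(perm_big _ perm_cliques) /= big_map big_seq [RHS]big_seq.
apply: eq_bigr => c; rewrite mem_cliques pairwise_set => /and3P[_ uc _].
by rewrite cardsE (card_uniqP uc).
Qed.

End Flag.

Lemma nclique0 (V : finType) (g : rel V) S : nclique g S 0 = 1%N.
Proof.
rewrite /nclique; elim: S => //= v S IHS; rewrite count_cat IHS count_map.
by rewrite (eq_count (a2 := pred0)) ?count_pred0.
Qed.

Lemma nclique1 (V : finType) (g : rel V) S : nclique g S 1 = size S.
Proof.
rewrite /nclique; elim: S => //= v S IHS; rewrite count_cat IHS count_map count_filter.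
rewrite -addn1; congr addn; rewrite -[RHS](nclique0 g S); apply: eq_count => c /=.
by case: c.
Qed.

(** As simplices have at most four vertices, 2^(#|V| - 4) divides every term of the sum. Cancelling
    it leaves 16 - 8 f_0 + 4 f_1 - 2 f_2 + f_3, whose negative terms are moved to the other side to
    stay in the natural numbers. *)
Lemma euler_char_cliques (V : finType) (T : {set {set V}}) (S : seq V) :
  is_complex T -> is_flag T -> uniq S -> (forall v, v \in S) ->
  (forall s, s \in T -> (#|s| <= 4)%N) -> (4 <= #|V|)%N ->
  (euler_char (davis_manifold T) == 0) =
  (16 + 4 * nclique (adjacent T) S 2 + nclique (adjacent T) S 4 ==
   8 * size S + 2 * nclique (adjacent T) S 3)%N.
Proof.
move=> Tc Tf Su Sall T4 V4.
set C := cliques (adjacent T) S.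
have C4 c : c \in C -> (size c < 5)%N.
  rewrite mem_cliques (pairwise_set Tc Tf) => /and3P[_ uc /T4].
  by rewrite cardsE (card_uniqP uc).
pose F k : int := (-1) ^+ k * 2 ^+ (#|V| - k).
have -> : euler_char (davis_manifold T) = \sum_(k < 5) F k *+ nclique (adjacent T) S k.
  rewrite euler_char_davis (sum_cliques Tc Tf Su Sall F).
  transitivity (\sum_(c <- C) \sum_(k < 5) if size c == k then F k else 0).
    rewrite big_seq [RHS]big_seq; apply: eq_bigr => c /C4 c4.
    rewrite (bigD1 (Ordinal c4)) //= eqxx big1 ?addr0 // => k.
    by rewrite eq_sym -val_eqE /= => /negPf ->.
  rewrite exchange_big; apply: eq_bigr => k _ /=.
  by rewrite -big_mkcond -big_filter big_const_seq count_predT size_filter iter_addr_0.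
rewrite !big_ord_recr big_ord0 /= nclique0 nclique1 /F add0r.
have -> : #|V| = (4 + (#|V| - 4))%N by rewrite subnKC.
set q := (#|V| - 4)%N; set a := nclique _ _ 2; set b := nclique _ _ 3; set d := nclique _ _ 4.
have -> : (4 + q - 0 = q + 4)%N by lia.
have -> : (4 + q - 1 = q + 3)%N by lia.
have -> : (4 + q - 2 = q + 2)%N by lia.
have -> : (4 + q - 3 = q + 1)%N by lia.
have -> : (4 + q - 4 = q)%N by lia.
rewrite !exprD.
set Q := 2 ^+ q.
rewrite [LHS](_ : _ =
  (Q * ((16 + 4 * a%:R + d%:R) - (8 * (size S)%:R + 2 * b%:R)) == 0)); last first.
  by congr (_ == _); ring.
rewrite mulf_eq0 expf_eq0 andbF /= subr_eq0.
by apply/eqP/eqP; lia.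
Qed.

(** * Ordered chains *)

(* Chains of ordered simplices, i.e. of lists of points, are handled through the values
   on them of functionals [g]: [lbd g l] is the value of [g] on the boundary of [l];
   [prism g] that on the prism between two simplices of the same dimension; [cone] that
   on a cone with apex [p] over [h N l] minus the track of [l] under the discrete
   homotopy [h]; [subd] that on the subdivision obtained by coning inductively. *)
Fixpoint lbd (P : Type) (g : seq P -> int) (l : seq P) : int :=
  if l is a :: l' then g l' - lbd (fun m => g (a :: m)) l' else 0.

Fixpoint prism (P : Type) (g : seq P -> int) (l : seq (P * P)) : int :=
  if l is ab :: l' then
    g (ab.1 :: ab.2 :: unzip2 l') - prism (fun m => g (ab.1 :: m)) l'
  else 0.

Definition cone (P : Type) (p : P) (h : nat -> P -> P) (N : nat)
    (g : seq P -> int) (l : seq P) : int :=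
  g (p :: map (h N) l) -
  \sum_(j < N) prism g (map (fun x => (h j x, h j.+1 x)) l).

Fixpoint subd (P V : Type) (c : V -> (seq P -> int) -> seq P -> int) (n : nat)
    (g : seq P -> int) (v : seq V) : int :=
  if n is n'.+1 then if v is a :: _ then lbd (subd c n' (c a g)) v else 0
  else g [::].

Lemma lbdB (P : Type) (g h : seq P -> int) l :
  lbd (fun m => g m - h m) l = lbd g l - lbd h l.
Proof.
elim: l g h => [|a l IHl] g h /=; first by rewrite subrr.
by rewrite IHl; ring.
Qed.

Lemma lbdZ (P : Type) (k : int) (g : seq P -> int) l :
  lbd (fun m => k * g m) l = k * lbd g l.
Proof.
by elim: l g => [|a l IHl] g /=; rewrite ?mulr0 // IHl; ring.
Qed.

Lemma lbd_sum (P : Type) (I : Type) (r : seq I) (F : I -> seq P -> int) l :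
  lbd (fun m => \sum_(i <- r) F i m) l = \sum_(i <- r) lbd (F i) l.
Proof.
elim: l F => [|a l IHl] F /=; first by rewrite big1_eq.
by rewrite IHl sumrB.
Qed.

Lemma lbd_map (P U : Type) (f : P -> U) (g : seq U -> int) l :
  lbd (fun m => g (map f m)) l = lbd g (map f l).
Proof. by elim: l g => //= a l IHl g; rewrite -IHl. Qed.

Lemma lbd_lbd (P : Type) (g : seq P -> int) l : lbd (lbd g) l = 0.
Proof.
elim: l g => //= a l IHl g.
by rewrite lbdB IHl subr0 subrr.
Qed.

(** Chains being seen only through functionals, a bound on the support of a chain reads: a
    functional that vanishes on all simplices of some kind vanishes on the chain. [prism_eq0],
    [cone_eq0] and [subd_eq0] serve the same purpose. *)
Lemma lbd_eq0 (P : eqType) (g : seq P -> int) l :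
  (forall m, (size m).+1 = size l -> {subset m <= l} -> g m = 0) ->
  lbd g l = 0.
Proof.
elim: l g => //= a l IHl g g0; rewrite g0 //; last first.
  by move=> x; rewrite inE => ->; rewrite orbT.
rewrite sub0r IHl ?oppr0 // => m sm ml; apply: g0 => /=; first by rewrite sm.
by move=> x; rewrite !inE => /orP[->//|/ml->]; rewrite orbT.
Qed.

Lemma lbd_ext (P : eqType) (g h : seq P -> int) l :
  (forall m, (size m).+1 = size l -> {subset m <= l} -> g m = h m) ->
  lbd g l = lbd h l.
Proof.
move=> gh; apply/eqP; rewrite -subr_eq0 -lbdB; apply/eqP/lbd_eq0 => m sm ml.
by rewrite gh ?subrr.
Qed.

Lemma prismB (P : Type) (g h : seq P -> int) l :
  prism (fun m => g m - h m) l = prism g l - prism h l.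
Proof.
elim: l g h => [|a l IHl] g h /=; first by rewrite subrr.
by rewrite IHl; ring.
Qed.

Lemma prismZ (P : Type) (k : int) (g : seq P -> int) l :
  prism (fun m => k * g m) l = k * prism g l.
Proof.
by elim: l g => [|a l IHl] g /=; rewrite ?mulr0 // IHl; ring.
Qed.

Lemma prism_sum (P : Type) (I : Type) (r : seq I) (F : I -> seq P -> int) l :
  prism (fun m => \sum_(i <- r) F i m) l = \sum_(i <- r) prism (F i) l.
Proof.
elim: l F => [|a l IHl] F /=; first by rewrite big1_eq.
by rewrite IHl sumrB.
Qed.

(** The chain homotopy formula: the boundary of a prism is its top minus its bottom minus the prism
    over the boundary. *)
Lemma prism_lbd (P : Type) (g : seq P -> int) l :
  prism (lbd g) l + lbd (prism g) l = g (unzip2 l) - g (unzip1 l).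
Proof.
elim: l g => [|[a b] l IHl] g /=; first by rewrite addr0 subrr.
have IHa := IHl (fun m => g (a :: m)).
rewrite prismB (lbdB (fun m => g [:: a, b & unzip2 m])).
rewrite (lbd_map snd (fun m => g [:: a, b & m])).
rewrite -[map snd l]/(unzip2 l) -/(unzip1 l).
by move: IHa => /(congr1 (fun x => x - lbd (prism (fun m => g (a :: m))) l));
   rewrite addrK => ->; ring.
Qed.

Lemma prism_eq0 (P : eqType) (g : seq P -> int) l :
  (forall m, size m = (size l).+1 ->
    {subset m <= unzip1 l ++ unzip2 l} -> g m = 0) ->
  prism g l = 0.
Proof.
elim: l g => //= -[a b] l IHl g g0; rewrite g0 //=; first last.
- move=> x; rewrite !inE mem_cat inE => /or3P[->//|->|->]; rewrite ?orbT //.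
- by rewrite size_map.
rewrite sub0r IHl ?oppr0 // => m sm ml; apply: g0 => /=; first by rewrite sm.
move=> x; rewrite !inE mem_cat inE => /orP[->//|/ml].
by rewrite mem_cat => /orP[]->; rewrite !orbT.
Qed.

Section Cone.
Variables (P : Type) (p : P) (h : nat -> P -> P) (N : nat).

Lemma coneB (g g' : seq P -> int) l :
  cone p h N (fun m => g m - g' m) l = cone p h N g l - cone p h N g' l.
Proof.
rewrite /cone; under eq_bigr do rewrite prismB.
by rewrite sumrB; ring.
Qed.

Lemma coneZ (k : int) (g : seq P -> int) l :
  cone p h N (fun m => k * g m) l = k * cone p h N g l.
Proof.
rewrite /cone; under eq_bigr do rewrite prismZ.
by rewrite -mulr_sumr; ring.
Qed.

Lemma cone_sum (I : Type) (r : seq I) (F : I -> seq P -> int) l :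
  cone p h N (fun m => \sum_(i <- r) F i m) l = \sum_(i <- r) cone p h N (F i) l.
Proof.
rewrite /cone sumrB exchange_big; congr (_ - _).
by apply: eq_bigr => j _; rewrite prism_sum.
Qed.

(** The boundary of a cone is the base minus the cone over the boundary. The ends of the prisms
    telescope to [map (h N) l] minus [l], and the face of the final simplex opposite to [p] cancels
    [map (h N) l]. *)
Lemma cone_lbd (g : seq P -> int) l :
  map (h 0) l = l ->
  cone p h N (lbd g) l + lbd (cone p h N g) l = g l.
Proof.
move=> h0; rewrite /cone /= lbdB (lbd_map (h N) (fun m => g (p :: m))).
rewrite lbd_sum.
have E j : lbd (fun m => prism g [seq (h j x, h j.+1 x) | x <- m]) l =
    lbd (prism g) [seq (h j x, h j.+1 x) | x <- l] by exact: lbd_map.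
under [in X in _ + X]eq_bigr do rewrite E.
rewrite [LHS](_ : _ = g (map (h N) l) - \sum_(j < N)
   (prism (lbd g) [seq (h j x, h j.+1 x) | x <- l] +
    lbd (prism g) [seq (h j x, h j.+1 x) | x <- l])); last first.
  by rewrite big_split /=; ring.
under eq_bigr => j _.
  rewrite prism_lbd /unzip1 /unzip2 -!map_comp /=.
  over.
rewrite -(big_mkord xpredT (fun j => g (map (h j.+1) l) - g (map (h j) l))).
by rewrite telescope_sumr // h0; ring.
Qed.

End Cone.

Lemma cone_eq0 (P : eqType) (p : P) h N (g : seq P -> int) l :
  g (p :: map (h N) l) = 0 ->
  (forall j m, (j < N)%N -> size m = (size l).+1 ->
    {subset m <= map (h j) l ++ map (h j.+1) l} -> g m = 0) ->
  cone p h N g l = 0.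
Proof.
move=> g0 gj; rewrite /cone g0 sub0r big1 ?oppr0 // => j _.
apply: prism_eq0 => m; rewrite size_map => sm ml; apply: (gj j) => //.
by move=> x /ml; rewrite /unzip1 /unzip2 -!map_comp.
Qed.

Section Subdivision.
Variables (P : Type) (V : eqType) (c : V -> (seq P -> int) -> seq P -> int).
Hypothesis cB : forall a g g' l, c a (fun m => g m - g' m) l = c a g l - c a g' l.
Hypothesis cZ : forall a k g l, c a (fun m => k * g m) l = k * c a g l.
Hypothesis clbd : forall a g l, c a (lbd g) l + lbd (c a g) l = g l.

Lemma subdB n g g' v :
  subd c n (fun m => g m - g' m) v = subd c n g v - subd c n g' v.
Proof.
elim: n g g' v => [//|n IHn] g g' [|a v]; first by rewrite /= subrr.
rewrite /=.
under [c a _]funext do rewrite cB.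
rewrite IHn; under [X in lbd X v]funext do rewrite IHn.
by rewrite lbdB; ring.
Qed.

Lemma subdZ n k g v : subd c n (fun m => k * g m) v = k * subd c n g v.
Proof.
elim: n g v => [//|n IHn] g [|a v]; first by rewrite /= mulr0.
rewrite /=.
under [c a _]funext do rewrite cZ.
rewrite IHn; under [X in lbd X v]funext do rewrite IHn.
by rewrite lbdZ; ring.
Qed.

(** Subdivision is a chain map, although each face is coned from its own first vertex: the boundary
    of the cone over the subdivided boundary is that subdivided boundary, minus a cone over its
    boundary, which vanishes by induction and [lbd_lbd]. *)
Lemma subd_lbd n g v : size v = n.+1 ->
  subd c n.+1 (lbd g) v = lbd (subd c n g) v.
Proof.
elim: n g v => [|n IHn] g [//|a v] [sv].
  by case: v sv => // _ /=; have := clbd a g [::]; rewrite /= addr0 => ->; ring.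
rewrite [LHS](_ : _ = lbd (subd c n.+1 (c a (lbd g))) (a :: v)) //.
have -> : c a (lbd g) = fun l => g l - lbd (c a g) l.
  by apply/funext => l; rewrite -(clbd a g l) addrK.
under [subd c _ _]funext do rewrite subdB.
rewrite lbdB (_ : lbd (subd c n.+1 (lbd (c a g))) _ = 0) ?subr0 //.
rewrite -[RHS](lbd_lbd (subd c n (c a g)) (a :: v)).
by apply: lbd_ext => m sm _; rewrite IHn //; case: sm => ->.
Qed.

Lemma subd0 n v : subd c n (fun=> 0) v = 0.
Proof.
have E : (fun=> 0) = (fun m : seq P => 0 * 0 :> int).
  by apply/funext => m; rewrite mul0r.
by rewrite E subdZ mul0r.
Qed.

Lemma subd_sum (I : Type) (r : seq I) n (F : I -> seq P -> int) v :
  subd c n (fun l => \sum_(i <- r) F i l) v = \sum_(i <- r) subd c n (F i) v.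
Proof.
elim: r => [|i r IHr].
  rewrite big_nil -[RHS](subd0 n v); congr subd.
  by apply/funext => l; rewrite big_nil.
pose S l := \sum_(j <- r) F j l.
rewrite big_cons -IHr -/S (_ : subd c n S v = - (subd c n (fun=> 0) v - subd c n S v)).
  rewrite -!subdB; congr (subd c n _ v); apply/funext => l.
  by rewrite big_cons sub0r opprK.
by rewrite subd0 sub0r opprK.
Qed.

(** [Fine k m l] is to be read: l may occur in the subdivision of the simplex m with k vertices. The
    first hypothesis says that coning from a vertex of a larger simplex u respects this. *)
Lemma subd_eq0 (Fine : nat -> seq V -> seq P -> Prop) n v g :
  (forall k a u m l f, a \in u -> {subset m <= u} -> Fine k m l ->
     (forall l', size l' = (size l).+1 -> Fine k.+1 u l' -> f l' = 0) ->
     c a f l = 0) ->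
  Fine 0 [::] [::] -> size v = n ->
  (forall l, size l = n -> Fine n v l -> g l = 0) -> subd c n g v = 0.
Proof.
move=> cF F0; elim: n v g => [|n IHn] [|a v] g //=.
  by move=> _; apply.
move=> [sv] g0; apply: (@lbd_eq0 _ (subd c n (c a g)) (a :: v)) => m [sm] mv.
apply: IHn => [|l sl Fl]; first by rewrite sm.
apply: (cF n a (a :: v) m) => //; first by rewrite inE eqxx.
by rewrite sl.
Qed.

End Subdivision.

Lemma lbdE (P : Type) (g : seq P -> int) l :
  lbd g l = \sum_(i < size l) (-1) ^+ i * g (take i l ++ drop i.+1 l).
Proof.
elim: l g => [|a l IHl] g; first by rewrite big_ord0.
rewrite [LHS]/= big_ord_recl IHl /= drop0 expr0 mul1r; congr (_ + _).
by rewrite -sumrN; apply: eq_bigr => i _; rewrite exprS; ring.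
Qed.

Lemma onth_omit (P : Type) (l : seq P) i j : (i < size l)%N ->
  onth (take i l ++ drop i.+1 l) j = onth l (bump i j).
Proof.
elim: l i j => [|a l IHl] [|i] j //= il; first by rewrite drop0 /bump.
by case: j => [|j] //=; rewrite IHl // /bump ltnS addnS.
Qed.

(** * Ordered simplices as alternating functions *)

Section Alt.
Variable V : finType.

(* The ordered simplex [l] as an alternating function of [s]. *)
Definition alt k (l : seq V) (s : k.-tuple V) : int :=
  \det (\matrix_(i < k, j < k) (onth l i == Some (tnth s j))%:R).

(** Expand the determinant along the column of v: in the sum over v, row i contributes once, for v
    the i-th entry of l. This reconciles [boundary], which prepends a vertex, with the alternating
    sum of faces. *)
Lemma boundary_alt k (l : seq V) (t : k.-tuple V) : size l = k.+1 ->
  \sum_(v : V) alt l [tuple of v :: t] = lbd (fun m => alt m t) l.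
Proof.
move=> sl; rewrite lbdE sl.
under eq_bigr => v _ do rewrite /alt (expand_det_col _ ord0).
rewrite exchange_big /=; apply: eq_bigr => i _.
under eq_bigr => v _ do rewrite mxE /cofactor addn0.
have [v0 Ev0] : exists v, onth l i = Some v.
  have : (i < size l)%N by rewrite sl.
  by rewrite -onthTE; case: (onth l i) => // v _; exists v.
rewrite (bigD1 v0) //= big1 ?addr0; last first.
  move=> v vN; rewrite Ev0 (tnth_nth v0) /=.
  by rewrite (_ : (Some v0 == Some v) = false) ?mul0r //; apply/eqP => -[E]; rewrite E eqxx in vN.
rewrite Ev0 (tnth_nth v0) /= eqxx mul1r; congr (_ * \det _).
apply/matrixP => a b; rewrite !mxE onth_omit ?sl //.
by congr ((_ == Some _)%:R); rewrite !(tnth_nth v0).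
Qed.

Lemma alt_perm k (l : seq V) (s : k.-tuple V) (p : 'S_k) :
  alt l [tuple tnth s (p i) | i < k] = (-1) ^+ p * alt l s.
Proof.
rewrite /alt -(odd_permV p) -(det_perm _ p^-1) mulrC -det_mulmx -col_permE.
by congr (\det _); apply/matrixP => i j; rewrite !mxE tnth_mktuple.
Qed.

Lemma alt_neq0 k (l : seq V) (s : k.-tuple V) : size l = k ->
  alt l s != 0 -> uniq s /\ s =i l.
Proof.
move=> sl; rewrite /alt => det0; split.
  apply/tuple_uniqP => i j sij; apply/eqP; apply: contraNT det0 => ij.
  rewrite -det_tr (determinant_alternate ij) // => a.
  by rewrite !mxE sij.
move=> x; apply/idP/idP.
- case/tnthP => j ->; apply: contraNT det0 => jl.
  rewrite (expand_det_col _ j) big1 // => i _; rewrite mxE.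
  case: eqP => [E|]; rewrite ?mul0r //.
  by case/negP: jl; move/(onth_nth (tnth s j)): E => <-; rewrite mem_nth ?sl.
- apply: contraLR => xs; apply/negP => xl.
  have il : (index x l < k)%N by rewrite -sl index_mem.
  case/negP: det0; rewrite (expand_det_row _ (Ordinal il)) big1 // => j _.
  rewrite mxE /= onthE (nth_map x) ?index_mem // nth_index //.
  case: eqP => [[E]|]; rewrite ?mul0r //.
  by case/negP: xs; rewrite E mem_tnth.
Qed.

Definition alternating k (c : {ffun k.-tuple V -> int}) :=
  forall (t : k.-tuple V) (p : 'S_k),
    c [tuple tnth t (p i) | i < k] = (-1) ^+ p * c t.

Lemma reindex_perm k (p : 'S_k) (F : k.-tuple V -> int) :
  \sum_t F t = \sum_t F [tuple tnth t (p i) | i < k].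
Proof.
rewrite (reindex_onto (fun t => [tuple tnth t (p i) | i < k])
  (fun t => [tuple tnth t (p^-1%g i) | i < k])) /=.
  by apply: eq_bigl => t; apply/eqP/eq_from_tnth => i; rewrite !tnth_mktuple permKV.
by move=> t _; apply/eq_from_tnth => i; rewrite !tnth_mktuple permK.
Qed.

(** The Leibniz formula selects the k! reorderings of s; each contributes [c s], because the sign of
    the permutation occurs twice. *)
Lemma sum_alt k (c : {ffun k.-tuple V -> int}) (s : k.-tuple V) :
  alternating c -> \sum_(v : k.-tuple V) c v * alt v s = c s *+ k`!.
Proof.
move=> calt.
rewrite /alt /determinant; under eq_bigr do rewrite mulr_sumr.
rewrite exchange_big /= -card_Sn -sumr_const; apply: eq_big => [p|p _].
  by rewrite !inE.
have Ep (v : k.-tuple V) :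
    \prod_(i < k) (\matrix_(i, j) (onth v i == Some (tnth s j))%:R) i (p i) =
    (v == [tuple tnth s (p i) | i < k])%:R :> int.
  under eq_bigr => i _ do
    rewrite mxE onthE (nth_map (tnth s i)) ?size_tuple // -tnth_nth.
  case: eqP => [->|vs].
    by rewrite big1 // => i _; rewrite tnth_mktuple eqxx.
  have [i vi] : exists i, tnth v i != tnth s (p i).
    apply/existsP; rewrite -negb_forall; apply/negP => /forallP vE.
    by apply/vs/eq_from_tnth => i; rewrite tnth_mktuple; apply/eqP.
  rewrite (bigD1 i) //= (_ : (Some _ == Some _) = false) ?mul0r //.
  by apply/eqP => -[E]; rewrite E eqxx in vi.
under eq_bigr do rewrite Ep.
rewrite (bigD1 [tuple tnth s (p i) | i < k]) //= eqxx big1 ?addr0.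
  by rewrite mulr1 calt mulrAC -expr2 sqrr_sign mul1r.
by move=> v /negPf ->; rewrite !mulr0.
Qed.

(** The sum is the value of [B] on the boundary of [c]: for each omitted position, the inner sum
    over the omitted vertex is, up to sign, a value of [boundary c]. *)
Lemma sum_lbd_cycle k (c : {ffun k.+1.-tuple V -> int}) (B : seq V -> int) :
  alternating c -> boundary c = 0 -> \sum_(v : k.+1.-tuple V) c v * lbd B v = 0.
Proof.
move=> calt c0.
under eq_bigr do rewrite lbdE size_tuple mulr_sumr.
rewrite exchange_big big1 // => i _.
(* [p] sends i to 0 and keeps the order of the other positions, so omitting position i from the
   permuted tuple leaves the tail of the original one. *)
pose p : 'S_k.+1 := lift_perm i ord0 1.
rewrite (reindex_perm p) /=.
have E (w : k.+1.-tuple V) :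
    take i [tuple tnth w (p i) | i < k.+1] ++
    drop i.+1 [tuple tnth w (p i) | i < k.+1] = behead w.
  set s := [tuple _ | _ < _].
  have ss : size (take i s ++ drop i.+1 s) = k.
    by rewrite size_cat size_take size_drop size_tuple ltn_ord subSS subnKC // -ltnS.
  apply: (@eq_from_nth _ (thead w)) => [|j]; first by rewrite ss size_behead size_tuple.
  rewrite ss => jk; rewrite -odflt_onth onth_omit ?size_tuple // odflt_onth.
  rewrite nth_behead -(tnth_nth _ s (lift i (Ordinal jk))) tnth_mktuple.
  by rewrite lift_perm_lift perm1 (tnth_nth (thead w)).
under eq_bigr do rewrite calt E.
rewrite (reindex (fun ut : V * k.-tuple V => [tuple of ut.1 :: ut.2])) /=; last first.
  exists (fun w => (thead w, [tuple of behead w])) => [[u t] _|w _] /=.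
    by congr pair; apply: val_inj.
  by rewrite -tuple_eta.
rewrite -(pair_big xpredT xpredT (fun u (t : k.-tuple V) =>
  (-1) ^+ p * c [tuple of u :: t] * ((-1) ^+ i * B t))) /=.
rewrite exchange_big big1 //= => t _.
rewrite -mulr_suml -mulr_sumr.
have /ffunP/(_ t) := c0; rewrite !ffunE => ->.
by rewrite mulr0 mul0r.
Qed.

End Alt.

(** * Topology of the realization *)

Section Topology.
Local Open Scope classical_set_scope.

(** * Fine subdivisions of simplices *)

Section Hull.
Variables (R : realType) (V : finType).
Notation P := 'rV[R]_#|V|.
Implicit Types (x y : P) (v : seq V).

Definition close n (d : R) (x y : 'rV[R]_n) := forall i, `|x 0 i - y 0 i| <= d.

Definition hull v : set P := [set x | [/\ forall i, 0 <= x 0 i,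
  \sum_i x 0 i = 1 & forall a, x 0 (enum_rank a) != 0 -> a \in v]]%classic.

Lemma hullS v u x : {subset v <= u} -> hull v x -> hull u x.
Proof. by move=> vu [x0 x1 xv]; split=> // a /xv/vu. Qed.

Lemma coord_le1 v x i : hull v x -> x 0 i <= 1.
Proof.
by move=> [x0 <- _]; rewrite (bigD1 i) //= lerDl sumr_ge0.
Qed.

Definition vertex (a : V) : P := delta_mx 0 (enum_rank a).

Definition toward (N : nat) (a : V) (j : nat) (x : P) : P :=
  (1 - j%:R / N%:R) *: x + (j%:R / N%:R) *: vertex a.

Lemma hull_vertex a v : a \in v -> hull v (vertex a).
Proof.
move=> av; split=> [i||b].
- by rewrite mxE eqxx ler0n.
- rewrite (bigD1 (enum_rank a)) //= mxE !eqxx big1 ?addr0 // => i ia.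
  by rewrite mxE (negPf ia) andbF.
- rewrite mxE eqxx /=; case: (enum_rank b =P enum_rank a) => [|_]; first by move/enum_rank_inj ->.
  by rewrite eqxx.
Qed.

Lemma towardE N a j x i : toward N a j x 0 i =
  (1 - j%:R / N%:R) * x 0 i + (j%:R / N%:R) * vertex a 0 i.
Proof. by rewrite /toward mxE [X in X + _]mxE [X in _ + X]mxE. Qed.

Lemma hull_toward N a j x v : (0 < N)%N -> (j <= N)%N -> a \in v ->
  hull v x -> hull v (toward N a j x).
Proof.
move=> N0 jN av [x0 x1 xv]; have [a0 a1 aav] := hull_vertex av.
have t0 : 0 <= j%:R / N%:R :> R by rewrite divr_ge0 ?ler0n.
have t1 : j%:R / N%:R <= 1 :> R.
  by rewrite ler_pdivrMr ?ltr0n // mul1r ler_nat.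
split=> [i||b].
- by rewrite towardE addr_ge0 ?mulr_ge0 ?subr_ge0.
- under eq_bigr do rewrite towardE.
  by rewrite big_split /= -!mulr_sumr x1 a1; ring.
- rewrite towardE => /eqP ab.
  have [/eqP/xv//|/aav//] : x 0 (enum_rank b) <> 0 \/ vertex a 0 (enum_rank b) != 0.
  case: (eqVneq (x 0 (enum_rank b)) 0) => [E|/eqP]; last by left.
  by right; apply/eqP => E'; apply: ab; rewrite E E' !mulr0 addr0.
Qed.

Lemma toward0 N a x : toward N a 0 x = x.
Proof. by rewrite /toward mul0r subr0 scale1r scale0r addr0. Qed.

Lemma towardN N a x : (0 < N)%N -> toward N a N x = vertex a.
Proof.
by move=> N0; rewrite /toward divff ?pnatr_eq0 -?lt0n // subrr scale0r add0r scale1r.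
Qed.

(** Moving towards a does not increase distances, and one step in time moves a point by at most
    1/N. *)
Lemma toward_close N a j k x y d v : (0 < N)%N -> (j <= N)%N -> (k <= N)%N ->
  (k <= j.+1)%N -> (j <= k.+1)%N -> 0 <= d ->
  hull v x -> hull v y -> a \in v -> close d x y ->
  close (d + N%:R^-1) (toward N a j x) (toward N a k y).
Proof.
move=> N0 jN kN kj jk d0 hx hy av xy i.
have [y0 _ _] := hy; have [a0 _ _] := hull_vertex av.
have N0' : 0 < N%:R :> R by rewrite ltr0n.
have t0 : 0 <= j%:R / N%:R :> R by rewrite divr_ge0 ?ler0n.
have t1 : j%:R / N%:R <= 1 :> R by rewrite ler_pdivrMr // mul1r ler_nat.
have -> : toward N a j x 0 i - toward N a k y 0 i =
    (1 - j%:R / N%:R) * (x 0 i - y 0 i) +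
    (j%:R / N%:R - k%:R / N%:R) * (vertex a 0 i - y 0 i).
  by rewrite !towardE; ring.
apply: le_trans (ler_normD _ _) _; rewrite !normrM lerD //.
  by rewrite -[leRHS]mul1r ler_pM // ger0_norm; lra.
rewrite -[leRHS]mulr1 ler_pM //.
  rewrite -mulrBl normrM [`|N%:R^-1|]ger0_norm ?invr_ge0 ?ler0n //.
  rewrite ler_piMl ?invr_ge0 ?ler0n // ler_norml lerBrDl lerBlDl.
  move: kj jk; rewrite -!(ler_nat R) -!natr1 => kj jk.
  by apply/andP; split; lra.
have := coord_le1 i hy; have := coord_le1 i (hull_vertex av).
by have := y0 i; have := a0 i; rewrite ler_norml; lra.
Qed.


Section Sperner.
Variables (N : nat) (N_gt0 : (0 < N)%N).

(** The cone is swept out by contracting linearly to a in N equal steps, the final simplex being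
    concentrated at a. Each coning adds only 1/N to the mesh, hence the bound k/N in [fine]: one
    subdivision with N large is as fine as desired. *)
Definition vcone (a : V) := cone (vertex a) (toward N a) N.

Definition fine (k : nat) v (l : seq P) := (forall x, x \in l -> hull v x) /\
  (forall x y, x \in l -> y \in l -> close (k%:R / N%:R) x y).

Lemma vcone_eq0 k a u m l f : a \in u -> {subset m <= u} -> fine k m l ->
  (forall l', size l' = (size l).+1 -> fine k.+1 u l' -> f l' = 0) ->
  vcone a f l = 0.
Proof.
move=> au mu [lm lk] f0.
have NR : 0 < N%:R :> R by rewrite ltr0n.
have lu x : x \in l -> hull u x by move=> /lm; apply: hullS.
have kS : k.+1%:R / N%:R = k%:R / N%:R + N%:R^-1 :> R.
  by rewrite -natr1; field; rewrite gt_eqF.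
apply: cone_eq0 => [|j l' jN sl' l'l].
  apply: f0; rewrite /= ?size_map //.
  have E x : x \in vertex a :: map (toward N a N) l -> x = vertex a.
    rewrite inE => /predU1P[//|/mapP[y _ ->]].
    by rewrite towardN.
  split=> [x /E->|x y /E-> /E-> i]; first exact: hull_vertex.
  by rewrite subrr normr0; apply: divr_ge0; rewrite ler0n.
have E x : x \in l' -> exists j' y,
    [/\ x = toward N a j' y, y \in l, (j <= j')%N & (j' <= j.+1)%N].
  move=> /l'l; rewrite mem_cat => /orP[]/mapP[y yl ->];
  by [exists j, y|exists j.+1, y].
apply: f0 => //; split=> [x|x y].
  move=> /E[j' [y [-> yl _ j'j]]]; apply: hull_toward => //; last exact: lu.
  exact: leq_trans j'j jN.
move=> /E[i [x' [-> x'l ji ij]]] /E[i' [y' [-> y'l ji' i'j]]].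
rewrite kS; apply: (@toward_close _ _ _ _ _ _ _ u) => //; try exact: lu.
- exact: leq_trans ij jN.
- exact: leq_trans i'j jN.
- exact: leq_trans i'j _.
- exact: leq_trans ij _.
- exact: lk.
Qed.

Lemma fine0 : fine 0 [::] [::].
Proof. by []. Qed.

Lemma subd_vcone_ext n v f g : size v = n ->
  (forall l, size l = n -> fine n v l -> f l = g l) ->
  subd vcone n f v = subd vcone n g v.
Proof.
move=> sv fg; apply/eqP; rewrite -subr_eq0 -subdB; last first.
  by move=> *; apply: coneB.
apply/eqP/(@subd_eq0 _ _ _ fine); [exact: vcone_eq0|exact: fine0|by []|].
by move=> l sl fl; rewrite fg // subrr.
Qed.

Lemma vcone_lbd a g l : vcone a (lbd g) l + lbd (vcone a g) l = g l.
Proof.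
apply: cone_lbd; rewrite -[RHS]map_id; apply/eq_map => x.
exact: toward0.
Qed.

Variable label : P -> V.
Hypothesis labelP : forall v x, hull v x -> label x \in v.

(* Sperner's lemma. *)
Lemma subd_alt n v (s : n.-tuple V) : size v = n ->
  subd vcone n (fun l => alt (map label l) s) v = alt v s.
Proof.
have cB a g g' l : vcone a (fun m => g m - g' m) l = vcone a g l - vcone a g' l.
  exact: coneB.
have cZ a k g l : vcone a (fun m => k * g m) l = k * vcone a g l by exact: coneZ.
have clbd := vcone_lbd.
elim: n v s => [|n IHn] v s sv.
  by rewrite (size0nil sv) /=.
(* If s has a repetition or an entry outside v, both sides vanish, since labels of points of the
   simplex v belong to v. *)
have [sv'|/negP nsv] := boolP (uniq s && all (mem v) s); last first.
  transitivity (0 : int).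
    apply: (@subd_eq0 _ _ vcone fine); [exact: vcone_eq0|exact: fine0|by []|].
  move=> l sl [lv _].
    apply/eqP/negPn/negP => /alt_neq0[]; first by rewrite size_map.
    move=> us sl'; apply: nsv; rewrite us; apply/allP => x.
    by rewrite sl' => /mapP[y /lv/labelP yv ->].
  apply/esym/eqP/negPn/negP => /alt_neq0[] // us sv'; apply: nsv.
  by rewrite us; apply/allP => x; rewrite sv'.
case/andP: sv' => us /allP sv'.
have svE : s =i v.
  by have [] := uniq_min_size us sv'; rewrite // size_tuple sv.
pose t := [tuple of behead s].
(* A function that vanishes off the orderings of v is recovered at s from the sum defining its
   boundary at the tail t, since only the head of s completes t to an ordering of v. This reduces
   the claim to the faces of v. *)
have only (F : n.+1.-tuple V -> int) :
    (forall r : n.+1.-tuple V, ~~ (uniq r && all (mem v) r) -> F r = 0) ->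
    F s = \sum_x F [tuple of x :: t].
  move=> Fz; rewrite (bigD1 (thead s)) //= big1 ?addr0.
    by congr F; rewrite {1}(tuple_eta s).
  move=> x xs; apply: Fz; apply/negP => /andP[/= /andP[xt ut] /andP[xv tv]].
  move: xv; rewrite /= -svE (tuple_eta s) inE (negPf xs) /=.
  by rewrite (negPf xt).
rewrite (only (fun s => subd _ _ (fun l => alt _ s) v)); last first.
  move=> r nr; apply: (@subd_eq0 _ _ vcone fine); [exact: vcone_eq0|exact: fine0|by []|].
  move=> l sl [lv _].
  apply/eqP/negPn/negP => /alt_neq0[]; first by rewrite size_map.
  move=> ur rl; case/negP: nr; rewrite ur; apply/allP => x.
  by rewrite rl => /mapP[y /lv/labelP yv ->].
rewrite (only (alt v)); last first.
  move=> r nr; apply/eqP/negPn/negP => /alt_neq0[] // ur rv; case/negP: nr.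
  by rewrite ur; apply/allP => x; rewrite rv.
rewrite boundary_alt // -subd_sum //.
rewrite (@subd_vcone_ext _ _ _ (lbd (fun m => alt (map label m) t))) //; last first.
  by move=> l sl _; rewrite boundary_alt ?size_map // (lbd_map label (fun m => alt m t)).
rewrite subd_lbd //; apply: lbd_ext => m; rewrite sv => -[sm] _.
exact: IHn.
Qed.

End Sperner.

(** * Filling a cycle along a discrete contraction *)

Section Filling.
Variables (T : {set {set V}}) (label : P -> V) (K : P -> Prop).
Hypothesis labelP : forall v x, hull v x -> label x \in v.
Variables (n N M : nat) (p : P) (h : nat -> P -> P).
Hypothesis N_gt0 : (0 < N)%N.
Hypothesis h0 : forall x, K x -> h 0 x = x.

Definition small (l : seq P) := (forall x, x \in l -> K x) /\
  (forall x y, x \in l -> y \in l -> close (n.+1%:R / N%:R) x y).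

Hypothesis step_label : forall j l l', (j < M)%N -> small l ->
  {subset l' <= map (h j) l ++ map (h j.+1) l} ->
  [set x in map label l']%SET \in T.
Hypothesis end_label : forall l, small l ->
  [set x in map label (p :: map (h M) l)]%SET \in T.

(** The chain w is the labelled cone over the subdivision of z. Its boundary is the labelled
    subdivision of z, which is z times (n+1)! by [subd_alt] and [sum_alt], minus a cone over the
    subdivided boundary of z, which vanishes by [sum_lbd_cycle]. Continuity of the contraction
    enters only through the labels met during one step. *)
Lemma filling (z : {ffun n.+1.-tuple V -> int}) :
  alternating z -> boundary z = 0 ->
  (forall v : n.+1.-tuple V, z v != 0 -> forall x, hull v x -> K x) ->
  exists2 w : {ffun n.+2.-tuple V -> int},
    is_chain T w & boundary w = z *+ (n.+1)`!.
Proof.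
move=> zalt z0 zK.
have cB a g g' l : vcone N a (fun m => g m - g' m) l =
  vcone N a g l - vcone N a g' l by exact: coneB.
have cZ a k g l : vcone N a (fun m => k * g m) l = k * vcone N a g l.
  exact: coneZ.
pose A k (s : k.-tuple V) (l : seq P) := alt (map label l) s.
(* [F s v] is the coefficient of s in the labelled cone over the subdivision of v. *)
pose F (s : n.+2.-tuple V) (v : seq V) := subd (vcone N) n.+1 (cone p h M (A _ s)) v.
have small_fine (v : n.+1.-tuple V) l : z v != 0 -> fine N n.+1 v l -> small l.
  by move=> /zK vK [lv lc]; split=> // x /lv/vK.
have Fperm s (q : 'S_n.+2) v : F [tuple tnth s (q i) | i < n.+2] v = (-1) ^+ q * F s v.
  rewrite /F -subdZ //; congr (subd _ _ _ v); apply/funext => l.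
  rewrite -coneZ; congr (cone _ _ _ _ l); apply/funext => m.
  exact: alt_perm.
have Fsupp (s : n.+2.-tuple V) (v : n.+1.-tuple V) : z v != 0 ->
    ~ (uniq s /\ [set x in s]%SET \in T) -> F s v = 0.
  move=> zv ns; apply: (@subd_eq0 _ _ (vcone N) (fine N));
    [exact: vcone_eq0|exact: fine0|exact: size_tuple|].
  move=> l sl fl; have sml := small_fine _ _ zv fl.
  have A0 m : size m = n.+2 -> [set x in map label m]%SET \in T -> A _ s m = 0.
    move=> sm mT; apply/eqP/negPn/negP => /alt_neq0[]; first by rewrite size_map.
    move=> us sE; apply: ns; split=> //.
    rewrite (_ : [set x in s]%SET = [set x in map label m]%SET) //.
    by apply/setP => x; rewrite !inE sE.
  apply: cone_eq0 => [|j m jM sm ml].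
    by apply: A0; [rewrite /= size_map sl|exact: end_label].
  by apply: A0; [rewrite sm sl|exact: step_label ml].
have Fbd (v : n.+1.-tuple V) (t : n.+1.-tuple V) : z v != 0 ->
    \sum_x F [tuple of x :: t] v = alt v t - lbd (subd (vcone N) n (cone p h M (A _ t))) v.
  move=> zv; rewrite -subd_sum //.
  rewrite -(subd_alt N_gt0 labelP) ?size_tuple //.
  rewrite -(subd_lbd cB) ?size_tuple //; last exact: vcone_lbd.
  rewrite -subdB //; apply: subd_vcone_ext => // [|l sl fl]; first exact: size_tuple.
  have [lK _] := small_fine _ _ zv fl.
  have hl : map (h 0) l = l.
    rewrite -[RHS]map_id; apply/eq_in_map => x /lK; exact: h0.
  rewrite -[alt _ _](cone_lbd p M (A _ t) hl) addrK.
  apply/eqP; rewrite -subr_eq0; apply/eqP.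
  transitivity (cone p h M (fun m => \sum_x A _ [tuple of x :: t] m - lbd (A _ t) m) l).
    by rewrite coneB cone_sum.
  have A0 m : size m = n.+2 ->
      \sum_x A _ [tuple of x :: t] m - lbd (A _ t) m = 0.
    move=> sm; rewrite /A boundary_alt ?size_map // -(lbd_map label (fun m => alt m t)).
    by rewrite subrr.
  by apply: cone_eq0 => [|j m jM sm ml]; apply: A0; rewrite ?sm /= ?size_map sl.
exists [ffun s => \sum_v z v * F s v].
  split=> [s q|s]; rewrite !ffunE.
    by rewrite mulr_sumr; apply: eq_bigr => v _; rewrite Fperm mulrCA.
  move=> sn0; apply/not_notP => ns; case/negP: sn0.
  rewrite big1 // => v _; have [->|zv] := eqVneq (z v) 0; first exact: mul0r.
  by rewrite Fsupp // mulr0.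
apply/ffunP => t; rewrite [LHS]ffunE.
under eq_bigr do rewrite ffunE.
rewrite exchange_big /=.
transitivity (\sum_v (z v * alt v t -
    z v * lbd (subd (vcone N) n (cone p h M (A _ t))) v)).
  apply: eq_bigr => v _; rewrite -mulr_sumr -mulrBr.
  by have [->|/Fbd->//] := eqVneq (z v) 0; rewrite !mul0r.
by rewrite sumrB sum_alt // sum_lbd_cycle // subr0 ffunMnE.
Qed.
End Filling.
End Hull.

Lemma compact_unif_continuous (R : realType) (X Y : pseudoMetricType R)
    (A : set X) (f : X -> Y) (e : R) :
  compact A -> {within A, continuous f} -> 0 < e ->
  exists2 d : R, 0 < d &
    forall x y, A x -> A y -> ball x d y -> ball (f x) e (f y).
Proof.
move=> cA /subspace_continuousP cf e0.
have /compact_near_coveringP nA := cA.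
have [d d0 dP] : \forall d \near (0 : R)^'+, A `<=`
    (fun x => A x -> forall y, A y -> ball x d y -> ball (f x) e (f y)).
  apply: (nA _ _ (fun d x => A x -> forall y, A y -> ball x d y -> ball (f x) e (f y))).
  move=> x Ax.
  have := cf x Ax (ball (f x) (e / 2)) (nbhsx_ballx _ _ _).
  rewrite divr_gt0 // => /(_ isT).
  rewrite /= /within /= => /nbhs_ballP[r /= r0 rP].
  exists (ball x (r / 2), [set d | d < r / 2]) => /=.
    split; first by apply: nbhsx_ballx; rewrite divr_gt0.
    by apply: nbhs_right_lt; rewrite divr_gt0.
  move=> [x' d] [/= xx' dr] Ax' y Ay x'y.
  have h z : A z -> ball x r z -> ball (f x) (e / 2) (f z).
    by move=> Az xz; apply: (rP z).
  rewrite [e]splitr; apply: ball_triangle (ball_sym (h x' Ax' _)) (h y Ay _).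
    by apply: le_ball xx'; lra.
  rewrite [r]splitr; apply: ball_triangle xx' _.
  by apply: le_ball x'y; exact: ltW.
exists (d / 2); first by rewrite divr_gt0.
move=> x y Ax Ay xy; apply: (dP (d / 2)) => //=; last by rewrite divr_gt0.
by rewrite sub0r normrN gtr0_norm ?divr_gt0 //; move: d0 => /=; lra.
Qed.

Lemma compact_inverse_continuous (X Y : topologicalType) (A : set X) (B : set Y)
    (f : X -> Y) (g : Y -> X) :
  compact A -> hausdorff_space Y -> {within A, continuous f} ->
  (forall x, A x -> B (f x) /\ g (f x) = x) ->
  (forall y, B y -> A (g y) /\ f (g y) = y) -> {within B, continuous g}.
Proof.
move=> cA hY cf fA gB; apply/continuous_closedP => C Cc.
apply/closed_subspaceP.
exists (f @` (A `&` C)); last first.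
  apply/seteqP; split=> [y [[x [Ax Cx] <-] By]|y [/= Cy By]].
    by have [_ E] := fA x Ax; split=> //; move: Cx; rewrite -{1}E.
  by have [Ag fg] := gB y By; split=> //; exists (g y).
apply: compact_closed => //; apply: continuous_compact; last first.
  by apply: compact_closedI.
apply: continuous_subspaceW cf; exact: subIsetl.
Qed.

(** * Euclidean norm and radial projection *)

Section Sphere.
Variable R : realType.

Definition enorm n (y : 'rV[R]_n) := Num.sqrt (\sum_i y 0 i ^+ 2).
Definition normalize n (y : 'rV[R]_n) := (enorm y)^-1 *: y.

Lemma enorm_ge0 n (y : 'rV[R]_n) : 0 <= enorm y.
Proof. exact: sqrtr_ge0. Qed.

Lemma enorm_sq n (y : 'rV[R]_n) : enorm y ^+ 2 = \sum_i y 0 i ^+ 2.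
Proof. by rewrite sqr_sqrtr // sumr_ge0 // => i _; rewrite sqr_ge0. Qed.

Lemma enorm_eq0 n (y : 'rV[R]_n) : (enorm y == 0) = (y == 0).
Proof.
rewrite -sqrf_eq0 enorm_sq psumr_eq0 => [|i _]; last exact: sqr_ge0.
apply/allP/eqP => [y0|-> i _]; last by rewrite mxE expr0n eqxx.
apply/rowP => i; rewrite mxE; apply/eqP; rewrite -sqrf_eq0.
exact: y0 (mem_index_enum _).
Qed.

Lemma sphere_normalize n (y : 'rV[R]_n.+1) : y != 0 -> @unit_sphere R n (normalize y).
Proof.
move=> y0; rewrite /unit_sphere /=; under eq_bigr do rewrite mxE exprMn.
by rewrite -mulr_sumr -enorm_sq -exprMn mulVf ?expr1n // enorm_eq0.
Qed.

Lemma sphere_enorm n (y : 'rV[R]_n.+1) : @unit_sphere R n y -> enorm y = 1.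
Proof. by rewrite /unit_sphere /= /enorm => ->; rewrite sqrtr1. Qed.

Lemma normalize_sphere n (y : 'rV[R]_n.+1) : @unit_sphere R n y -> normalize y = y.
Proof. by move=> /sphere_enorm; rewrite /normalize => ->; rewrite invr1 scale1r. Qed.

Lemma enorm_continuous n : continuous (@enorm n).
Proof.
move=> y; apply: (@continuous_comp _ _ _ (fun y : 'rV[R]_n => \sum_i y 0 i ^+ 2) Num.sqrt).
  apply: (@cvg_big _ _ _ _ _ _ _ (nbhs y)) => [|i _]; first exact: add_continuous.
  by apply: cvgM; apply: coord_continuous.
exact: sqrt_continuous.
Qed.

Lemma normalize_continuous n (y : 'rV[R]_n) : y != 0 -> {for y, continuous (@normalize n)}.
Proof.
move=> y0; apply: continuousZ; last exact: cvg_id.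
by apply: continuousV; [rewrite enorm_eq0|exact: enorm_continuous].
Qed.

Lemma sphere_neq0 n (y : 'rV[R]_n.+1) : @unit_sphere R n y -> y != 0.
Proof. by move=> /sphere_enorm y1; rewrite -enorm_eq0 y1 oner_eq0. Qed.

Lemma sphereN n (y : 'rV[R]_n.+1) : @unit_sphere R n y -> @unit_sphere R n (- y).
Proof.
by rewrite /unit_sphere /=; under [in X in _ -> X]eq_bigr do rewrite mxE sqrrN.
Qed.

(** If the segment from y to - q meets the origin, comparing norms in (1 - t) y = t q gives 1 - t =
    t, hence y = q. So for y other than q the normalized segment is a path on the sphere from y to -
    q. *)
Lemma segment_neq0 n (y q : 'rV[R]_n.+1) (t : R) : @unit_sphere R n y ->
  @unit_sphere R n q -> y <> q -> 0 <= t <= 1 -> (1 - t) *: y - t *: q != 0.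
Proof.
move=> y1 q1 yq /andP[t0 t1]; apply/eqP => /eqP; rewrite subr_eq0 => /eqP E.
have eZ c (x : 'rV[R]_n.+1) : @unit_sphere R n x -> 0 <= c -> enorm (c *: x) = c.
  move=> x1 c0; rewrite /enorm; under eq_bigr do rewrite mxE exprMn.
  by rewrite -mulr_sumr (_ : \sum_i _ = 1) // mulr1 sqrtr_sqr ger0_norm.
have := congr1 (@enorm _) E; rewrite !eZ // ?subr_ge0 // => tE.
have t2 : t != 0.
  by apply/eqP => tz; move: tE => /eqP; rewrite tz subr0 oner_eq0.
by apply: yq; apply: (scalerI t2); rewrite -E tE.
Qed.

End Sphere.

(** * Compactness of the realization, and labels of its points *)

Section Realization.
Variables (R : realType) (V : finType) (T : {set {set V}}).
Hypothesis Tc : is_complex T.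
Notation P := 'rV[R]_#|V|.
Notation X := (@geom_realization R V T).

Lemma coord_closed (i : 'I_#|V|) (C : set R) : closed C -> closed [set x : P | C (x 0 i)].
Proof.
by apply: (proj1 (continuous_closedP (fun x : P => x 0 i))); exact: coord_continuous.
Qed.

Lemma geom_compact : compact X.
Proof.
have [_ _ Tsub] := Tc.
have XE : X = [set x : P | forall i, `[0, 1]%classic (x 0 i)] `&`
   ([set x : P | \sum_i x 0 i = 1] `&` \bigcup_(s in [set` T])
      \bigcap_(v in [set v | v \notin s]) [set x : P | x 0 (enum_rank v) = 0]).
  apply/seteqP; split=> [x [x0 x1 xT]|x [x0 [x1 [s sT sx]]]].
    split=> [i|]; [|split=> //].
      rewrite /= in_itv /= x0 /= -x1 (bigD1 i) //= lerDl.
      by apply: sumr_ge0 => j _.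
    exists [set v : V | x 0 (enum_rank v) != 0]%SET => // v /=.
    by rewrite inE negbK => /eqP.
  split=> [i||]; [by have := x0 i; rewrite /= in_itv => /andP[]|exact: x1|].
  apply: Tsub sT _; apply/fintype.subsetP => v; rewrite inE; apply: contraNT => vs.
  by apply/eqP; exact: sx.
rewrite XE; apply: compact_closedI.
  have h := @rV_compact R #|V| (fun=> `[0, 1]%classic) (fun=> @segment_compact _ 0 1).
  exact: h.
apply: closedI.
  suff cs : continuous (fun x : P => \sum_i x 0 i).
    exact: (proj1 (continuous_closedP _) cs _ (@closed_eq _ (1 : R))).
  move=> x; apply: (@cvg_big _ _ _ _ _ _ _ (nbhs x)) => [|i _]; first exact: add_continuous.
  exact: coord_continuous.
apply: closed_bigcup => [|s _]; first exact: finite_finset.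
apply: closed_bigI => v _; apply: (@coord_closed _ [set y | y = 0]).
exact: closed_eq.
Qed.

Lemma geom_hull (v : seq V) (x : P) : [set x in v]%SET \in T -> hull v x -> X x.
Proof.
have [_ _ Tsub] := Tc.
move=> vT [x0 x1 xv]; split=> //; apply: Tsub vT _.
by apply/fintype.subsetP => a; rewrite !inE; exact: xv.
Qed.

Variable v0 : V.
(* The average of the barycentric coordinates is [#|V|^-1]: points at mutual distance
   less than that have labels in the support of any one of them. *)
Definition label (x : P) : V :=
  odflt v0 [pick v | #|V|%:R^-1 <= x 0 (enum_rank v)].

Lemma cardV_gt0 : 0 < #|V|%:R :> R.
Proof. by rewrite ltr0n; apply/card_gt0P; exists v0. Qed.

Lemma label_ge (x : P) : \sum_i x 0 i = 1 ->
  #|V|%:R^-1 <= x 0 (enum_rank (label x)).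
Proof.
move=> x1; rewrite /label; case: pickP => //= small.
suff : \sum_i x 0 i < 1 by rewrite x1 ltxx.
have -> : 1 = \sum_(i < #|V|) #|V|%:R^-1 :> R.
  by rewrite sumr_const card_ord -[_ *+ _]mulr_natr mulVf // gt_eqF // cardV_gt0.
apply: ltr_sum => [|i _]; last by rewrite ltNge -(enum_valK i) small.
by apply/hasP; exists (enum_rank v0); rewrite ?mem_index_enum.
Qed.

Lemma label_hull v x : hull v x -> label x \in v.
Proof.
move=> [_ x1]; apply; rewrite gt_eqF //.
by apply: lt_le_trans (label_ge x1); rewrite invr_gt0 cardV_gt0.
Qed.

Lemma labels_simplex (l : seq P) : (forall x, x \in l -> X x) ->
  (forall x y, x \in l -> y \in l -> ball x (#|V|%:R^-1) y) ->
  [set x in map label l]%SET \in T.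
Proof.
have [T0 _ Tsub] := Tc.
case: l => [|x l] lX lb.
  by rewrite (_ : [set x in _]%SET = finset.set0) //; apply/setP => x; rewrite !inE.
have [x0 x1 xT] := lX x (mem_head _ _).
apply: Tsub xT _; apply/fintype.subsetP => v; rewrite !inE => vl.
have {vl} /mapP[y yl ->] : v \in map label (x :: l) by rewrite inE.
have [_ /(_ 0 (enum_rank (label y)))] := lb x y (mem_head _ _) yl.
have [_ y1 _] := lX y yl; have := label_ge y1.
rewrite /ball /= => yge; rewrite ltr_distlC => /andP[_ xlt].
rewrite gt_eqF //; lra.
Qed.

End Realization.

Lemma cvg_comp_within (T U W : topologicalType) (F : set_system T) (FF : Filter F)
    (f : T -> U) (B : set U) (g : U -> W) (y : U) :
  f x @[x --> F] --> y -> (\forall x \near F, B (f x)) ->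
  g z @[z --> within B (nbhs y)] --> g y -> g (f x) @[x --> F] --> g y.
Proof.
move=> fy fB gy A /gy Ag.
have {}fy : F (fun x => B (f x) -> A (g (f x))) by exact: fy Ag.
by apply: filterS2 fB fy => x Bx; apply.
Qed.

Lemma cycle_covers (R : realType) (m : nat) (V : finType) (T : {set {set V}})
    (n : nat) (z : {ffun n.+1.-tuple V -> int}) (s : {set V}) :
  sphere_triangulation R m T -> is_cycle T z -> s \in T ->
  (forall t : n.+1.-tuple V, z t != 0 -> ~~ (s \subset [set x in t]%SET)) ->
  exists2 w : {ffun n.+2.-tuple V -> int},
    is_chain T w & boundary w = z *+ (n.+1)`!.
Proof.
move=> [Tc [F [G [cF cG FP GP]]]] [[zalt zT] z0] sT zs.
have [s0|[v0 v0s]] := set_0Vmem s.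
  have {z0 zT zalt}-> : z = 0.
    apply/ffunP => t; rewrite ffunE; apply/eqP/negPn/negP => /zs.
    by rewrite s0 finset.sub0set.
  exists 0; last first.
    apply/ffunP => t; rewrite mul0rn !ffunE big1 // => v _; by rewrite ffunE.
  by split=> [t p|t]; rewrite !ffunE ?mulr0 ?eqxx.
pose X := @geom_realization R V T.
pose b : 'rV[R]_#|V| := \row_i (if enum_val i \in s then #|s|%:R^-1 else 0).
have s_gt0 : 0 < #|s|%:R :> R by rewrite ltr0n; apply/card_gt0P; exists v0.
have bX : X b.
  split=> [i||].
  - by rewrite mxE; case: ifP => // _; rewrite invr_ge0 ltW.
  - rewrite (reindex (@enum_rank V)) /=; last exact/onW_bij/enum_rank_bij.
    under eq_bigr do rewrite mxE enum_rankK.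
    rewrite -big_mkcond /= sumr_const.
    by rewrite -[_ *+ _]mulr_natr mulVf // gt_eqF.
  - rewrite (_ : [set v | _]%SET = s) //; apply/setP => v; rewrite !inE mxE enum_rankK.
    by case: ifP => // _; [rewrite invr_eq0 gt_eqF|rewrite eqxx].
(* The points whose support does not contain s: a compact set that misses b and contains every
   simplex in the support of z. *)
pose K : set 'rV[R]_#|V| := X `&` \bigcup_(v in [set` s])
  [set x : 'rV[R]_#|V| | x 0 (enum_rank v) = 0].
have Kc : compact K.
  apply: compact_closedI (geom_compact Tc) _.
  apply: closed_bigcup => [|v _]; first exact: finite_finset.
  by apply: (@coord_closed _ _ _ [set y | y = 0]); exact: closed_eq.
pose q := F b.
have Sq : unit_sphere q by have [] := FP b bX.
have Fq x : K x -> F x <> q.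
  move=> [Xx [v vs xv]] E; have := (FP x Xx).2; rewrite E (FP b bX).2 => bx.
  move: xv; rewrite /= -bx mxE enum_rankK vs => /eqP.
  by rewrite invr_eq0 gt_eqF.
(* Off [q], the sphere contracts to [- q] along great circles through [q]. *)
pose Psi (u : R * 'rV[R]_#|V|) := G (normalize ((1 - u.1) *: F u.2 - u.1 *: q)).
pose D : set (R * 'rV[R]_#|V|) := `[0, 1] `*` K.
have neq u : D u -> (1 - u.1) *: F u.2 - u.1 *: q != 0.
  move=> [u1 u2]; have uS : unit_sphere (F u.2) by have [] := FP _ (proj1 u2).
  have u01 : 0 <= u.1 <= 1 by move: u1; rewrite /= in_itv.
  exact: segment_neq0 uS Sq (Fq _ u2) u01.
have PsiX u : D u -> X (Psi u).
  by move=> Du; have [] := GP _ (sphere_normalize (neq _ Du)).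
have Psi0 x : K x -> Psi (0, x) = x.
  move=> Kx; rewrite /Psi /= subr0 scale1r scale0r subr0 normalize_sphere.
    by rewrite (FP x (proj1 Kx)).2.
  by have [] := FP x (proj1 Kx).
have Psi1 x : Psi (1, x) = G (- q).
  by rewrite /Psi /= subrr scale0r add0r scale1r normalize_sphere //; exact: sphereN.
have cPsi : {within D, continuous Psi}.
  apply/subspace_continuousP => -[t x] Dtx.
  have [_ Kx] := Dtx.
  have cF' : F u.2 @[u --> within D (nbhs (t, x))] --> F x.
    apply: (@cvg_comp_within _ _ _ _ _ snd X F).
    - exact: cvg_trans (cvg_app _ (cvg_within _)) cvg_snd.
    - by apply: filterS (near_withinT _ _) => u [_ []].
    - by move/subspace_continuousP/(_ x (proj1 Kx)): cF.
  have cy : (1 - u.1) *: F u.2 - u.1 *: q @[u --> within D (nbhs (t, x))] -->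
      (1 - t) *: F x - t *: q.
    have ct : u.1 @[u --> within D (nbhs (t, x))] --> t.
      exact: cvg_trans (cvg_app _ (cvg_within _)) cvg_fst.
    apply: cvgB; apply: cvgZ => //; last exact: cvg_cst.
    by apply: cvgB => //; exact: cvg_cst.
  pose nf (u : R * 'rV[R]_#|V|) := normalize ((1 - u.1) *: F u.2 - u.1 *: q).
  apply: (@cvg_comp_within _ _ _ _ _ nf (@unit_sphere R m) G (nf (t, x))).
  - apply: (cvg_comp _ _ cy); exact: normalize_continuous (neq _ Dtx).
  - by apply: filterS (near_withinT _ _) => u Du; exact: sphere_normalize (neq _ Du).
  - move/subspace_continuousP: cG; apply; exact: sphere_normalize (neq _ Dtx).
have V_gt0 := cardV_gt0 R v0.
have Vi_gt0 : 0 < #|V|%:R^-1 :> R by rewrite invr_gt0.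
have [d d0 dP] := compact_unif_continuous (compact_setX (@segment_compact R 0 1) Kc) cPsi Vi_gt0.
(* The same N measures the subdivision and the time steps: the mesh (n+1)/N and the step 1/N are
   both less than the modulus d. *)
pose N := (Num.truncn (n.+1%:R / d)).+1.
have N0 : 0 < N%:R :> R by rewrite ltr0n.
have Nd : n.+1%:R / N%:R < d.
  rewrite ltr_pdivrMr // mulrC -ltr_pdivrMr //.
  by rewrite truncnS_gt // ?divr_ge0 // ltW.
have Nd1 : N%:R^-1 < d.
  apply: le_lt_trans Nd; rewrite -[leLHS]mul1r ler_pM2r ?invr_gt0 //.
  by rewrite ler1n.
(* Each stage is computed from the initial point, because moved points may leave K. *)
pose h (j : nat) x := Psi (j%:R / N%:R, x).
have D01 j x : (j <= N)%N -> K x -> D (j%:R / N%:R, x).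
  move=> jN Kx; split=> //=; rewrite in_itv /= divr_ge0 ?ler0n //=.
  by rewrite ler_pdivrMr // mul1r ler_nat.
have Kball x y : K x -> K y -> close (n.+1%:R / N%:R) x y -> ball x d y.
  move=> _ _ xy; split=> // i j; rewrite ord1 /ball /=.
  exact: le_lt_trans (xy j) Nd.
apply: (@filling R V T (label v0) K (@label_hull _ _ v0) n N N (G (- q)) h) => //.
- by move=> x Kx; rewrite /h mul0r Psi0.
- move=> j l l' jN [lK lc] l'l.
  have E x : x \in l' -> exists j' y,
      [/\ x = h j' y, y \in l & (j <= j' <= j.+1)%N].
    move=> /l'l; rewrite mem_cat => /orP[]/mapP[y yl ->].
      by exists j, y; rewrite leqnn leqnSn.
    by exists j.+1, y; rewrite leqnn leqnSn.
  apply: labels_simplex => [//|x /E[j' [y [-> yl /andP[_ j'j]]]]|x y].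
    by apply: PsiX; apply: D01; [exact: leq_trans j'j jN|exact: lK].
  move=> /E[i [x' [-> x'l /andP[ji ij]]]] /E[i' [y' [-> y'l /andP[ji' i'j]]]].
  apply: dP; [apply: D01|apply: D01|split=> /=]; try exact: lK.
  + exact: leq_trans ij jN.
  + exact: leq_trans i'j jN.
  + rewrite /ball /= -mulrBl normrM [`|N%:R^-1|]ger0_norm ?invr_ge0 ?ler0n //.
    apply: le_lt_trans Nd1; rewrite ler_piMl ?invr_ge0 ?ler0n // ler_norml.
    move: ji ij ji' i'j; rewrite -!(ler_nat R) -!natr1 => ji ij ji' i'j.
    by apply/andP; split; lra.
  + by apply: Kball; [exact: lK|exact: lK|exact: lc].
- move=> l [lK _].
  have E x : x \in G (- q) :: map (h N) l -> x = G (- q).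
    rewrite inE => /predU1P[//|/mapP[y _ ->]].
    by rewrite /h divff ?gt_eqF // Psi1.
  apply: labels_simplex => [//|x /E ->|x y /E -> /E ->].
    by have [] := GP _ (sphereN Sq).
  exact: ballxx.
- move=> v zv x vx; split.
    exact: geom_hull (zT _ zv).2 vx.
  have /fintype.subsetPn[a as_ av] := zs v zv; exists a => //=.
  apply/eqP/negPn/negP; have [_ _ xv] := vx; move=> /xv av'.
  by case/negP: av; rewrite inE.
Qed.

(** * Boundaries of simplicial polytopes *)

Section Polytope.
Variables (R : realType) (V I : finType) (T : {set {set V}}) (n : nat).
Variables (S : I -> {set V}) (i0 : I).
Variables (p : V -> 'rV[R]_n.+1) (r : I -> V -> 'cV[R]_n.+1).
Notation X := (@geom_realization R V T).

(* [S i] is the vertex set of the i-th facet of a convex polytope with vertices [p],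
   and [r i] the basis dual to [p] on [S i]; the facet lies in [height i = 1]. *)
Definition pairing (a : 'cV[R]_n.+1) (y : 'rV[R]_n.+1) : R := (y *m a) 0 0.
Definition height (i : I) (y : 'rV[R]_n.+1) : R := \sum_(v in S i) pairing (r i v) y.

Hypothesis Tc : is_complex T.
Hypothesis TS : forall s, (s \in T) = [exists i, s \subset S i].
Hypothesis dual : forall i v w, v \in S i -> w \in S i ->
  pairing (r i v) (p w) = (v == w)%:R.
Hypothesis dual_basis : forall i y, \sum_(v in S i) pairing (r i v) y *: p v = y.
Hypothesis convex : forall i w, w \notin S i -> height i (p w) < 1.
Hypothesis ridge : forall i v, v \in S i ->
  exists2 j, S i :\ v \subset S j & v \notin S j.

Lemma pairing_sum (J : Type) (s : seq J) (Q : pred J) (c : J -> R) (F : J -> 'rV[R]_n.+1) a :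
  pairing a (\sum_(j <- s | Q j) c j *: F j) = \sum_(j <- s | Q j) c j * pairing a (F j).
Proof.
rewrite /pairing mulmx_suml summxE; apply: eq_bigr => j _.
by rewrite -scalemxAl mxE.
Qed.

Lemma height_sum (J : Type) (s : seq J) (Q : pred J) (c : J -> R) (F : J -> 'rV[R]_n.+1) i :
  height i (\sum_(j <- s | Q j) c j *: F j) = \sum_(j <- s | Q j) c j * height i (F j).
Proof.
rewrite /height; under eq_bigr do rewrite pairing_sum.
by rewrite exchange_big; apply: eq_bigr => j _; rewrite mulr_sumr.
Qed.

Lemma pairingZ c a y : pairing a (c *: y) = c * pairing a y.
Proof. by rewrite /pairing -scalemxAl mxE. Qed.

Lemma heightZ c i y : height i (c *: y) = c * height i y.
Proof. by rewrite mulr_sumr; apply: eq_bigr => v _; rewrite pairingZ. Qed.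

Lemma height_vertex i v : v \in S i -> height i (p v) = 1.
Proof.
move=> vS; rewrite /height (bigD1 v) //= dual // eqxx big1 ?addr0 // => w /andP[wS wv].
by rewrite dual // (negPf wv).
Qed.

Lemma height_le1 i v : height i (p v) <= 1.
Proof.
by have [/height_vertex->//|/convex/ltW//] := boolP (v \in S i).
Qed.

Definition place (x : 'rV[R]_#|V|) : 'rV[R]_n.+1 := \sum_v x 0 (enum_rank v) *: p v.

Lemma sum_coord (x : 'rV[R]_#|V|) : \sum_v x 0 (enum_rank v) = \sum_i x 0 i.
Proof. by rewrite [RHS](reindex (@enum_rank V)) //=; exact/onW_bij/enum_rank_bij. Qed.

Lemma height_place_le1 i x : X x -> height i (place x) <= 1.
Proof.
move=> [x0 x1 _]; rewrite height_sum -x1 -sum_coord.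
by apply: ler_sum => v _; rewrite ler_piMr // height_le1.
Qed.

Lemma height_place_eq1 i x : X x -> height i (place x) = 1 ->
  forall v, v \notin S i -> x 0 (enum_rank v) = 0.
Proof.
move=> [x0 x1 _] hx v vS; apply/eqP.
have : \sum_w x 0 (enum_rank w) * (1 - height i (p w)) == 0.
  under eq_bigr do rewrite mulrBr mulr1.
  by rewrite sumrB sum_coord x1 -height_sum -/(place x) hx subrr.
rewrite psumr_eq0 => [/allP/(_ v (mem_index_enum _))|w _]; last first.
  by rewrite mulr_ge0 // subr_ge0 height_le1.
rewrite mulf_eq0 => /orP[//|]; rewrite subr_eq0 => /eqP h1.
by have := convex vS; rewrite -h1 ltxx.
Qed.

Lemma support_facet x : X x -> exists2 i, height i (place x) = 1 &
  forall v, v \notin S i -> x 0 (enum_rank v) = 0.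
Proof.
move=> [x0 x1]; rewrite TS => /existsP[i /fintype.subsetP sS]; exists i; last first.
  by move=> v; apply: contraNeq => xv; apply: sS; rewrite inE.
rewrite height_sum -x1 -sum_coord; apply: eq_bigr => v _.
have [vS|vS] := boolP (v \in S i); first by rewrite height_vertex // mulr1.
suff -> : x 0 (enum_rank v) = 0 by rewrite mul0r.
by apply/eqP; apply: contraNT vS => xv; apply: sS; rewrite inE.
Qed.

Lemma coord_pairing i (x : 'rV[R]_#|V|) v : (forall v, v \notin S i -> x 0 (enum_rank v) = 0) ->
  v \in S i -> x 0 (enum_rank v) = pairing (r i v) (place x).
Proof.
move=> xS vS; rewrite pairing_sum (bigD1 v) //= dual // eqxx mulr1 big1 ?addr0 // => w wv.
have [wS|/xS->] := boolP (w \in S i); last by rewrite mul0r.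
by rewrite dual // eq_sym (negPf wv) mulr0.
Qed.

Lemma place_neq0 x : X x -> place x != 0.
Proof.
move=> /support_facet[i h1 _]; apply: contra_eq_neq h1 => ->.
by rewrite /height big1 ?(eq_sym 0) ?oner_eq0 // => v _; rewrite /pairing mul0mx mxE.
Qed.

(** If the two places differ by a factor c, the height of the facet of x gives 1 <= c and that of
    the facet of y gives c <= 1. So c = 1, both points lie on the facet of x, and the dual basis
    reads off their coordinates. *)
Lemma normalize_place_inj x y : X x -> X y ->
  normalize (place x) = normalize (place y) -> x = y.
Proof.
move=> Xx Xy; have px := place_neq0 Xx; have py := place_neq0 Xy.
have [i hx xS] := support_facet Xx; have [j hy yS] := support_facet Xy.
pose c := enorm (place x) / enorm (place y).
rewrite /normalize => E; have {E} xy : place x = c *: place y.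
  by rewrite /c -scalerA -E scalerA divff ?scale1r // enorm_eq0.
have c_gt0 : 0 < c.
  by rewrite divr_gt0 // lt_def enorm_ge0 enorm_eq0 ?px ?py.
have c1 : c = 1.
  have hi := height_place_le1 i Xy; have hj := height_place_le1 j Xx.
  move: hx hj; rewrite xy !heightZ hy mulr1 => hx cj; apply/eqP.
  by rewrite eq_le cj -hx ler_piMr // ltW.
rewrite c1 scale1r in xy; rewrite xy in hx.
have yS' := height_place_eq1 Xy hx.
apply/rowP => k; rewrite -(enum_valK k); set v := enum_val k.
have [vS|vS] := boolP (v \in S i); last by rewrite xS // yS'.
by rewrite (coord_pairing xS) // (coord_pairing yS') // xy.
Qed.

(** The ray through y leaves the polytope at the facet of largest height on y: were the coefficient
    of y at a vertex v of that facet negative, the facet across the ridge opposite to v would be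
    higher on y. *)
Lemma normalize_place_surj y : unit_sphere y -> exists2 x, X x & normalize (place x) = y.
Proof.
move=> y1; have y0 := sphere_neq0 y1.
pose i := [arg max_(i > i0) height i y]%O.
have imax j : height j y <= height i y by rewrite /i; case: arg_maxP => // k _; apply.
pose a v := if v \in S i then pairing (r i v) y else 0.
have ya : y = \sum_v a v *: p v.
  rewrite -[LHS](dual_basis i) big_mkcond; apply: eq_bigr => v _.
  by rewrite /a; case: ifP => // _; rewrite scale0r.
have a0 v : 0 <= a v.
  rewrite /a; case: ifP => // vS; rewrite leNgt; apply/negP => av.
  have [j Sj vj] := ridge vS.
  have := imax j; rewrite leNgt => /negP; apply.
  rewrite -[y in X in _ < X](dual_basis i) -[y in X in X < _](dual_basis i) !height_sum.
  rewrite (bigD1 v) //= [ltRHS](bigD1 v) //= ltr_leD //.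
    rewrite height_vertex // mulr1 -subr_gt0 -[X in _ - X]mulr1 -mulrBr.
    by rewrite nmulr_rgt0 // subr_lt0 convex.
  rewrite le_eqVlt; apply/orP; left; apply/eqP/eq_bigr => w /andP[wS wv].
  rewrite !height_vertex //.
  by apply: (fintype.subsetP Sj); rewrite !inE wv.
pose s := \sum_v a v.
have s_gt0 : 0 < s.
  rewrite lt_def sumr_ge0 // andbT; apply: contraNneq y0 => s0.
  rewrite ya big1 // => v _; apply/eqP; rewrite scaler_eq0; apply/orP; left.
  by move/eqP: s0; rewrite psumr_eq0 // => /allP/(_ v (mem_index_enum _)).
pose x : 'rV[R]_#|V| := \row_k (a (enum_val k) / s).
have xE v : x 0 (enum_rank v) = a v / s by rewrite mxE enum_rankK.
have px : place x = s^-1 *: y.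
  rewrite /place ya scaler_sumr; apply: eq_bigr => v _.
  by rewrite xE scalerA mulrC.
exists x.
  split=> [k||].
  - by rewrite mxE divr_ge0 // ltW.
  - rewrite -sum_coord; under eq_bigr do rewrite xE.
    by rewrite -mulr_suml divff // gt_eqF.
  - rewrite TS; apply/existsP; exists i; apply/fintype.subsetP => v.
    rewrite inE xE /a; case: ifP => // _; by rewrite mul0r eqxx.
rewrite px /normalize; have -> : enorm (s^-1 *: y) = s^-1.
  rewrite /enorm; under eq_bigr do rewrite mxE exprMn.
  rewrite -mulr_sumr (_ : \sum_i _ = 1) // mulr1 sqrtr_sqr ger0_norm //.
  by rewrite invr_ge0 ltW.
by rewrite invrK scalerA divff ?scale1r // gt_eqF.
Qed.

Lemma polytope_sphere : homeomorphic X (@unit_sphere R n).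
Proof.
pose f x := normalize (place x).
have fX x : X x -> unit_sphere (f x).
  by move=> Xx; apply: sphere_normalize; exact: place_neq0.
have /choice[g gP] : forall y, exists x, unit_sphere y -> X x /\ f x = y.
  move=> y; have [y1|ny1] := pselect (unit_sphere y); last by exists 0.
  by have [x Xx <-] := normalize_place_surj y1; exists x.
have fP x : X x -> unit_sphere (f x) /\ g (f x) = x.
  move=> Xx; split; first exact: fX.
  by have [Xg fg] := gP _ (fX x Xx); exact: normalize_place_inj fg.
have cf : {within X, continuous f}.
  apply/subspace_continuousP => x Xx.
  apply: (@cvg_comp _ _ _ place (@normalize R _) _ (nbhs (place x))); last first.
    exact: normalize_continuous (place_neq0 Xx).
  apply: (cvg_trans (cvg_app _ (cvg_within _))).
  apply: (@cvg_big _ _ _ _ _ _ _ (nbhs x)) => [|v _]; first exact: add_continuous.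
  by apply: cvgZ; [exact: coord_continuous|exact: cvg_cst].
exists f, g; split=> //.
apply: (compact_inverse_continuous (geom_compact Tc) _ cf fP gP).
exact: norm_hausdorff.
Qed.

End Polytope.

End Topology.

(** * Maps of nonzero degree *)

Section Chains.
Variables (V : finType) (T : {set {set V}}).

Lemma boundaryB k (c c' : {ffun k.+1.-tuple V -> int}) :
  boundary (c - c') = boundary c - boundary c'.
Proof.
apply/ffunP => t; rewrite !ffunE -sumrB.
by apply: eq_bigr => v _; rewrite !ffunE.
Qed.

Lemma boundaryMn k (c : {ffun k.+1.-tuple V -> int}) n :
  boundary (c *+ n) = boundary c *+ n.
Proof.
apply/ffunP => t; rewrite ffunMnE !ffunE -sumrMnl.
by apply: eq_bigr => v _; rewrite ffunMnE.
Qed.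

Lemma is_chainB k (c c' : {ffun k.-tuple V -> int}) :
  is_chain T c -> is_chain T c' -> is_chain T (c - c').
Proof.
move=> [ca cT] [c'a c'T]; split=> [t p|t].
  by rewrite !ffunE ca c'a mulrBr.
rewrite !ffunE; have [->|/cT//] := eqVneq (c t) 0.
by rewrite sub0r oppr_eq0 => /c'T.
Qed.

Lemma is_chainMn k (c : {ffun k.-tuple V -> int}) n : is_chain T c -> is_chain T (c *+ n).
Proof.
move=> [ca cT]; split=> [t p|t]; first by rewrite !ffunMnE ca mulrnAr.
rewrite ffunMnE; have [->|/cT//] := eqVneq (c t) 0.
by rewrite mul0rn eqxx.
Qed.

Lemma is_chain0 k : is_chain T (0 : {ffun k.-tuple V -> int}).
Proof. by split=> [t p|t]; rewrite !ffunE ?mulr0 ?eqxx. Qed.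

Lemma alternating_uniq k (c : {ffun k.-tuple V -> int}) (t : k.-tuple V) :
  alternating c -> c t != 0 -> uniq t.
Proof.
move=> ca ct; apply/tuple_uniqP => i j tij; apply/eqP; apply: contraNT ct => ij.
have := ca t (tperm i j); rewrite odd_tperm ij expr1 mulN1r.
rewrite (_ : [tuple _ | _ < _] = t); first by lia.
apply/eq_from_tnth => a; rewrite tnth_mktuple.
by case: tpermP => [->|->|].
Qed.

End Chains.

Lemma sum_cons_tuple (W : finType) k (F : k.+1.-tuple W -> int) :
  \sum_s F s = \sum_u \sum_(s : k.-tuple W) F [tuple of u :: s].
Proof.
rewrite pair_big /=.
rewrite (reindex (fun us : W * k.-tuple W => [tuple of us.1 :: us.2])) //=.
exists (fun w => (thead w, [tuple of behead w])) => [[u s] _|w _] /=.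
  by congr pair; apply: val_inj.
by rewrite -tuple_eta.
Qed.

Section Domination.
Variables (W V : finType) (T0 : {set {set W}}) (T : {set {set V}}) (f : W -> V).
Hypothesis fs : simplicial_map T0 T f.

Lemma chain_map_cycle n (z : {ffun n.+1.-tuple W -> int}) :
  is_cycle T0 z -> is_cycle T (chain_map f z).
Proof.
move=> [[za zT] z0].
have ca : alternating (chain_map f z).
  move=> t p; rewrite !ffunE big_mkcond (reindex_perm p) /= [in RHS]big_mkcond mulr_sumr.
  apply: eq_bigr => s _.
  have -> : ([tuple of map f [tuple tnth s (p i) | i < n.+1]] ==
      [tuple tnth t (p i) | i < n.+1]) = ([tuple of map f s] == t).
    apply/eqP/eqP => [E|<-]; apply/eq_from_tnth => i; last first.
      by rewrite [RHS]tnth_mktuple [LHS]tnth_map [in LHS]tnth_mktuple [RHS]tnth_map.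
    have := congr1 (fun u => tnth u (p^-1%g i)) E.
    by rewrite [LHS]tnth_map [in LHS]tnth_mktuple tnth_mktuple permKV tnth_map.
  by case: eqP => _; rewrite ?mulr0 // za.
split; first split=> // t ct.
  split; first exact: alternating_uniq ct.
  have [s /andP[/eqP <- zs]] : exists s : n.+1.-tuple W, ([tuple of map f s] == t) && (z s != 0).
    apply/existsP; apply: contraNT ct => /existsPn sz.
    rewrite ffunE big1 // => s st; apply/eqP.
    by have := sz s; rewrite st negbK.
  have [_ sT] := zT s zs; have := fs sT.
  rewrite (_ : (f @: _)%SET = [set x in [tuple of map f s]]%SET) //.
  apply/setP => x; rewrite inE; apply/imsetP/mapP => -[y ys ->]; exists y => //.
    by rewrite inE in ys.
  by rewrite inE.
apply/ffunP => t; rewrite !ffunE.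
under eq_bigr do rewrite ffunE.
transitivity (\sum_(s : n.-tuple W | [tuple of map f s] == t) boundary z s); last first.
  by rewrite z0 big1 // => s _; rewrite ffunE.
under [RHS]eq_bigr do rewrite ffunE.
rewrite [RHS]big_mkcond.
under eq_bigr do rewrite big_mkcond sum_cons_tuple exchange_big.
rewrite exchange_big; apply: eq_bigr => s _ /=.
rewrite exchange_big /=.
transitivity (\sum_(u : W) if [tuple of map f s] == t then z [tuple of u :: s] else 0).
  apply: eq_bigr => u _; rewrite (bigD1 (f u)) //= [X in _ + X]big1 ?addr0.
    by rewrite -!val_eqE /= eqseq_cons eqxx.
  move=> v vu; rewrite -val_eqE /= eqseq_cons.
  by rewrite eq_sym (negPf vu).
by case: eqP => // _; rewrite big1_eq.
Qed.

Variables (R : realType) (m n : nat) (d : int).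
Hypotheses (Ts : sphere_triangulation R m T) (d0 : d != 0).
Hypothesis fd : has_degree T0 T n f d.

(** If the image of z missed a simplex, (n+1)! times it would bound. It is also homologous to d
    (n+1)! z', so the zero cycle would have both 0 and d (n+1)! as coefficients, against
    uniqueness. *)
Lemma degree_covers : exists c : {ffun n.+1.-tuple V -> int},
  [/\ is_cycle T c,
    forall t, c t != 0 -> exists2 s : n.+1.-tuple W, [set x in s]%SET \in T0 & map f s = t &
    forall s, s \in T -> exists2 t, c t != 0 & s \subset [set x in t]%SET].
Proof.
have [z [z' [[zc _] [z'c z'P] [w0 w0T w0E]]]] := fd.
exists (chain_map f z); split; first exact: chain_map_cycle.
  move=> t ct; have [s /andP[/eqP <- zs]] :
      exists s : n.+1.-tuple W, ([tuple of map f s] == t) && (z s != 0).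
    apply/existsP; apply: contraNT ct => /existsPn sz.
    rewrite ffunE big1 // => s st; apply/eqP.
    by have := sz s; rewrite st negbK.
  by exists s => //; have [[_ zT] _] := zc; have [] := zT s zs.
move=> s sT; apply: contrapT => ns.
have [t ct|w wT wE] := cycle_covers Ts (chain_map_cycle zc) sT.
  by apply/negP => st; apply: ns; exists t.
have zero_cycle : is_cycle T (0 : {ffun n.+1.-tuple V -> int}).
  split; first exact: is_chain0.
  by apply/ffunP => t; rewrite !ffunE big1 // => v _; rewrite ffunE.
have [k [_ kP]] := z'P 0 zero_cycle.
have k0 : k = 0.
  apply: kP; exists 0; first exact: is_chain0.
  rewrite mulr0z subrr; apply/ffunP => t.
  by rewrite !ffunE big1 // => v _; rewrite ffunE.
have : k = d *+ (n.+1)`!.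
  apply: kP; exists (w0 *+ (n.+1)`! - w).
    by apply: is_chainB => //; exact: is_chainMn.
  rewrite boundaryB boundaryMn -w0E wE mulrnBl addrAC subrr.
  by rewrite -mulr_natr mulrzA natz -pmulrn.
rewrite k0 => /esym/eqP; rewrite mulrn_eq0 (negPf d0) orbF => /eqP f0.
by have := fact_gt0 n.+1; rewrite f0.
Qed.
End Domination.

(** * Flag complexes covered by a 3-cycle *)

Section FlagPseudomanifold.
Variables (V : finType) (T : {set {set V}}) (c : {ffun 4.-tuple V -> int}).
Hypotheses (Tc : is_complex T) (Tf : is_flag T) (cc : @is_cycle V T 3 c).
Hypothesis cover : forall s, s \in T -> exists2 t, c t != 0 & s \subset [set x in t]%SET.
Notation g := (adjacent T).

Lemma clique_le4 (s : {set V}) : s \in T -> (#|s| <= 4)%N.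
Proof.
case/cover => t _ /subset_leq_card st; apply: leq_trans st _.
by rewrite cardsE -[X in (_ <= X)%N](size_tuple t) card_size.
Qed.

Lemma no_clique5 (l : seq V) : size l = 5 -> ~~ pairwise g l.
Proof.
move=> l5; rewrite (pairwise_set Tc Tf); apply/negP => /andP[ul /clique_le4].
by rewrite cardsE (card_uniqP ul) l5.
Qed.

(** Some tetrahedron over the triangle l has a nonzero coefficient, and the coefficients over l sum
    to zero, so there is a second one. *)
Lemma two_apexes (l : seq V) : pairwise g l -> size l = 3 ->
  exists u v, [/\ u != v, all (g u) l & all (g v) l].
Proof.
have [[ca cT] c0] := cc.
rewrite (pairwise_set Tc Tf) => /andP[ul lT] l3.
pose t := Tuple (introT eqP l3).
have [s cs ls] := cover lT.
have us := alternating_uniq ca cs.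
have ls' : {subset l <= s}.
  by move=> x xl; have := fintype.subsetP ls x; rewrite !inE; apply.
have [u us' ul'] : exists2 u, u \in s & u \notin l.
  apply/hasP/negPn/negP => /hasPn sl.
  have : (size s <= size l)%N.
    by apply: uniq_leq_size us _ => x /sl; rewrite negbK.
  by rewrite size_tuple l3.
have apex x : c [tuple of x :: t] != 0 -> all (g x) l.
  move=> cx; have [/= ux xT] := cT _ cx.
  have : pairwise g (x :: l).
    by rewrite (pairwise_set Tc Tf); apply/andP; split; [exact: ux|exact: xT].
  by rewrite /= => /andP[].
have cu : c [tuple of u :: t] != 0.
  have : perm_eq s [tuple of u :: t].
    rewrite perm_sym; apply: uniq_perm => //=; first by rewrite ul' ul.
    apply: (uniq_min_size _ _ _).2; rewrite /= ?ul' ?ul ?size_tuple ?l3 //.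
    by move=> x; rewrite inE => /predU1P[->//|/ls'].
  case/tuple_permP => p sE; move: cs.
  rewrite (_ : s = [tuple tnth [tuple of u :: t] (p i) | i < 4]); last exact: val_inj.
  by rewrite ca mulf_eq0 signr_eq0.
have [v vu cv] : exists2 v, v != u & c [tuple of v :: t] != 0.
  have : \sum_v c [tuple of v :: t] = 0 by have /ffunP/(_ t) := c0; rewrite !ffunE.
  rewrite (bigD1 u) //= => S0; apply: contrapT => nv; case/negP: cu.
  rewrite -S0 big1 ?addr0 // => v vu; apply/eqP/negPn/negP => cv.
  by apply: nv; exists v.
by exists u, v; rewrite eq_sym vu !apex.
Qed.

(** One of the two apexes of l differs from x, and if it were adjacent to x there would be a
    5-clique. *)
Lemma opposite x (l : seq V) : pairwise g (x :: l) -> size l = 3 ->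
  exists y, [/\ y != x, all (g y) l & ~~ g x y].
Proof.
move=> xl l3; have /andP[gx gl] := xl.
have [u [v [uv gu gv]]] := two_apexes gl l3.
have [y yx gy] : exists2 y, y != x & all (g y) l.
  by have [ux|] := eqVneq u x; [exists v; rewrite // -ux eq_sym|exists u].
exists y; split=> //; apply/negP => gxy.
have /negP[] : ~~ pairwise g [:: y, x & l] by apply: no_clique5; rewrite /= l3.
by rewrite pairwise_cons /= adjacent_sym gxy gy; apply/andP.
Qed.

Lemma card_ge8 : (8 <= #|V|)%N.
Proof.
have [T0 _ _] := Tc; have [[ca cT] _] := cc.
have [t ct _] := cover T0.
have [ut tT] := cT t ct.
have : pairwise g t by rewrite (pairwise_set Tc Tf) ut.
case: t {ct ut tT} => -[//|a [//|b [//|e [//|d [|//]]]]] /= _.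
move=> gt; have := gt; rewrite !andbT => /and3P[/and3P[ab ae ad] /andP[be bd] ed].
have gS := adjacent_sym T.
have [a' [a'a /= /and4P[a'b a'e a'd _] na]] : exists y,
  [/\ y != a, all (g y) [:: b; e; d] & ~~ g a y].
  by apply: opposite => //=; rewrite ab ae ad be bd ed.
have [b' [b'b /= /and4P[b'a b'e b'd _] nb]] : exists y,
  [/\ y != b, all (g y) [:: a; e; d] & ~~ g b y].
  by apply: opposite => //=; rewrite (gS b) ab ae ad be bd ed.
have [e' [e'e /= /and4P[e'a e'b e'd _] ne]] : exists y,
  [/\ y != e, all (g y) [:: a; b; d] & ~~ g e y].
  by apply: opposite => //=; rewrite (gS e) (gS e b) ab ae ad be bd ed.
have [d' [d'd /= /and4P[d'a d'b d'e _] nd]] : exists y,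
  [/\ y != d, all (g y) [:: a; b; e] & ~~ g d y].
  by apply: opposite => //=; rewrite !(gS d) ab ae ad be bd ed.
have gN x y : g x y -> x != y by case/andP.
(* An apex opposite to x is not adjacent to x, whereas the apexes opposite to the other vertices
   are; this separates the four apexes. *)
have opp x x' y' : g x' x -> ~~ g x y' -> x' != y'.
  by move=> xx'; apply: contraNneq => <-; rewrite gS.
have u8 : uniq [:: a; b; e; d; a'; b'; e'; d'].
  rewrite /= !inE !negb_or -!andbA.
  repeat (apply/andP; split); rewrite //; first
    [ by apply: gN | by rewrite eq_sym | by rewrite eq_sym; apply: gN
    | match goal with
      | H : is_true (g ?x' ?x), H' : is_true (~~ g ?x ?y') |- is_true (?x' != ?y') =>
          exact: (opp x x' y' H H')
      end ].
by rewrite cardE; apply: (uniq_leq_size u8) => x _; rewrite mem_enum.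
Qed.

End FlagPseudomanifold.

(** * From domination to isomorphism *)

Section Rigidity.
Variables (R : realType) (m : nat) (W V : finType).
Variables (T0 : {set {set W}}) (T : {set {set V}}).
Variables (n : nat) (adj : rel nat) (w : nat -> W).
Hypothesis T0c : is_complex T0.
Hypothesis adjE : forall i j, (i < n)%N -> (j < n)%N -> adjacent T0 (w i) (w j) = adj i j.
Hypothesis w_onto : forall x, exists2 i, (i < n)%N & w i = x.
Hypothesis checked : search n (backs adj n) [::] [::].

Lemma dominates_iso : sphere_triangulation R m T -> is_flag T ->
  euler_char (davis_manifold T) != 0 -> dominates 3 T0 T -> complex_iso T T0.
Proof.
move=> Ts Tf chi [f [fs [d d0 fd]]].
have [Tc _] := Ts.
have [c [cc csupp cover]] := degree_covers fs Ts d0 fd.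
have [_ T1 Tsub] := Tc; have [_ _ T0sub] := T0c.
have image s : s \in T -> exists2 r, r \in T0 & s \subset (f @: r)%SET.
  move=> /cover[t /csupp[r rT rE] st]; exists [set x in r]%SET => //.
  apply: fintype.subset_trans st _; apply/fintype.subsetP => x; rewrite inE => xt.
  have /mapP[y yr ->] : x \in map f r by rewrite rE.
  by apply: imset_f; rewrite inE.
have f_onto v : exists x, f x = v.
  have [r _] := image _ (T1 v); rewrite finset.sub1set => /imsetP[x _ ->].
  by exists x.
have cl4 s : s \in T -> (#|s| <= 4)%N by exact: clique_le4 cover s.
have V8 : (8 <= #|V|)%N := card_ge8 Tc Tf cc cover.
have v0 : V by have [] := set_0Vmem [set: V]%SET => [E|[]//]; move: V8; rewrite -cardsT E cards0.
have uf : uniq (map (f \o w) (iota 0 n)).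
  apply: (@exhaustive_search _ (adjacent T) n adj (f \o w) v0) => //.
  - exact: adjacent_sym.
  - exact: adjacent_irr.
  - by move=> i j ni nj; rewrite -!adjE // adjacent_sym.
  - move=> i j ni nj; rewrite -adjE // => /andP[_ ij] fij.
    by rewrite /adjacent fij /=; have := fs _ ij; rewrite imsetU1 imset_set1.
  (* An edge of T lies in the image of a simplex of T0, so it lifts to an edge of that simplex. *)
  - move=> u v /andP[uv /image[r rT uvr]].
    move: uvr; rewrite finset.subUset !finset.sub1set => /andP[/imsetP[x xr ux] /imsetP[y yr vy]].
    have [[i ni ix] [j nj jy]] := (w_onto x, w_onto y).
    exists i, j; rewrite /= ix jy; split=> //; rewrite -adjE // ix jy /adjacent.
    rewrite (_ : x != y); last by apply: contraNneq uv => xy; rewrite ux vy xy.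
    by apply: T0sub rT _; rewrite finset.subUset !finset.sub1set xr.
  - by move=> v; have [x fx] := f_onto v; have [i ni ix] := w_onto x; exists i; rewrite //= ix.
  - exact: no_clique5 Tc Tf cover.
  - move=> S uS allS; rewrite -euler_char_cliques //.
    exact: leq_trans V8.
  - move=> S l uS allS gl l3; have [u [v [uv gu gv]]] := two_apexes Tc Tf cc cover gl l3.
    rewrite -size_filter; apply: (@uniq_leq_size _ [:: u; v]); first by rewrite /= inE uv.
    by move=> x; rewrite !inE mem_filter allS andbT => /orP[]/eqP->.
have f_inj : injective f.
  move=> x y; have [[i ni <-] [j nj <-]] := (w_onto x, w_onto y) => E; congr w.
  have := nth_uniq (f (w i)) _ _ uf => /(_ i j); rewrite size_map size_iota.
  move=> /(_ ni nj); rewrite !(nth_map 0%N) ?size_iota // !nth_iota //= E eqxx.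
  by move=> /esym/eqP.
have fT (s : {set W}) : ((f @: s)%SET \in T) = (s \in T0).
  apply/idP/idP => [/image[r rT sr]|/fs//]; apply: T0sub rT _.
  apply/fintype.subsetP => x xs; have := fintype.subsetP sr (f x) (imset_f f xs).
  by case/imsetP => y yr /f_inj ->.
have [h fh] : exists h, forall v, f (h v) = v.
  by have /choice[h hP] := f_onto; exists h.
have hf x : h (f x) = x by apply: f_inj; rewrite fh.
exists h; first by exists f.
move=> s; rewrite -fT -imset_comp; congr (_ \in T).
by rewrite (eq_imset _ (g := id)) ?imset_id // => v /=; rewrite fh.
Qed.

End Rigidity.

(** * The two triangulations *)

Lemma flag_complexP (V : finType) (e : rel V) (s : {set V}) :
  reflect (forall x y, x \in s -> y \in s -> x != y -> e x y) (s \in flag_complex e).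
Proof.
rewrite inE; apply: (iffP forall_inP) => [sP x y xs ys xy|sP x xs].
  by have /forall_inP/(_ y ys)/implyP := sP x xs; apply.
by apply/forall_inP => y ys; apply/implyP; exact: sP.
Qed.

Section FlagComplex.
Variables (V : finType) (e : rel V).

Lemma flag_complex_is_complex : is_complex (flag_complex e).
Proof.
split=> [|v|s t /flag_complexP sP /fintype.subsetP ts]; apply/flag_complexP.
- by move=> x y; rewrite inE.
- by move=> x y; rewrite !inE => /eqP -> /eqP ->; rewrite eqxx.
- by move=> x y /ts xs /ts ys; exact: sP.
Qed.

Lemma flag_complex_is_flag : is_flag (flag_complex e).
Proof.
move=> s sP; apply/flag_complexP => x y xs ys xy.
have /flag_complexP := sP x y xs ys xy; apply=> //; by rewrite !inE eqxx ?orbT.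
Qed.

Lemma adjacent_flag_complex x y : symmetric e ->
  adjacent (flag_complex e) x y = (x != y) && e x y.
Proof.
move=> es; rewrite /adjacent; case: eqVneq => //= xy.
apply/flag_complexP/idP => [|exy a b]; first by apply; rewrite ?inE ?eqxx ?orbT.
by rewrite !inE => /orP[]/eqP-> /orP[]/eqP->; rewrite ?eqxx // es.
Qed.

End FlagComplex.

(** * Integer certificates for the two polytopes *)

Definition dot (u v : seq int) : int := foldr (fun x s => x.1 * x.2 + s) 0 (zip u v).

Lemma dotE (k : nat) (u v : seq int) : size u = k -> size v = k ->
  dot u v = \sum_(c < k) u`_c * v`_c.
Proof.
elim: k u v => [|k IHk] [|a u] [|b v] //; first by rewrite big_ord0.
by move=> [su] [sv]; rewrite big_ord_recl /dot /= -/(dot u v) IHk.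
Qed.

(** The determinant, expanded along the first row of a list of rows so that it can be evaluated by
    computation. *)
Fixpoint laplace (k : nat) (M : seq (seq int)) : int :=
  if k is k'.+1 then if M is u :: M' then
    foldr (fun j s => (-1) ^+ j * u`_j * laplace k' [seq take j v ++ drop j.+1 v | v <- M'] + s)
      0 (iota 0 k)
  else 0 else 1.

Definition unit_vector (c : nat) : seq int := mkseq (fun d => (c == d)%:R) 4.

(* Cramer's rule: the dual basis of the rows of [M], multiplied by [|det M|]. *)
Definition cramer (M : seq (seq int)) : seq (seq int) :=
  let s := Num.sg (laplace 4 M) in
  mkseq (fun a => mkseq (fun c => s * laplace 4 (set_nth [::] M a (unit_vector c))) 4) 4.

Arguments laplace : simpl never.
Arguments cramer : simpl never.

Definition column (c : nat) (M : seq (seq int)) := [seq u`_c | u <- M].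

Lemma nth_column c M a : (a < size M)%N -> (column c M)`_a = (nth [::] M a)`_c.
Proof. by move=> aM; rewrite (nth_map [::]). Qed.

Definition facet_points (pts : seq (seq int)) (F : seq nat) := [seq nth [::] pts i | i <- F].

(** The hypotheses of [polytope_sphere] with the denominator D cleared. The two matrix identities
    state that r / D is inverse to M on either side; the last two checks are [convex] and
    [ridge]. *)
Definition facet_ok (adj : rel nat) (n : nat) (pts : seq (seq int)) (facets : seq (seq nat))
    (F : seq nat) : bool :=
  let M := facet_points pts F in
  let D := `|laplace 4 M| in
  let r := cramer M in
  [&& size F == 4%N, uniq F, all (gtn n) F,
   all (fun i => all (fun j => (i == j) || adj i j) F) F,
   0 < D,
   all (fun a => all (fun b => dot (nth [::] r a) (nth [::] M b) == D *+ (a == b)) (iota 0%N 4))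
     (iota 0%N 4),
   all (fun c => all (fun d => dot (column c r) (column d M) == D *+ (c == d)) (iota 0%N 4))
     (iota 0%N 4),
   all (fun i => (i \in F) || (foldr (fun u s => dot u (nth [::] pts i) + s) 0 r < D)) (iota 0 n) &
   all (fun i => has (fun G => all (fun j => (j == i) || (j \in G)) F && (i \notin G)) facets) F].

(** The last check places every clique in a facet; as facets are cliques, the boundary of the
    polytope is the flag complex of the graph. *)
Definition polytope_ok (adj : rel nat) (n : nat) (pts : seq (seq int)) (facets : seq (seq nat)) :=
  [&& all (fun u => size u == 4) pts, size pts == n, 0 < size facets,
    all (facet_ok adj n pts facets) facets &
    all (fun c => has (fun F => all (mem F) c) facets) (cliques adj (iota 0 n))]%N.

Definition adj10 i j := (((i < 5) != (j < 5)) || ((i + 5 - j) %% 5 \in [:: 1; 4]))%N.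
Definition adj12 i j := (
  if i < 9 then if j < 9 then (i + 9 - j) %% 9 \in [:: 1; 2; 3; 6; 7; 8]
                else i %% 3 != j - 9
  else if j < 9 then j %% 3 != i - 9 else false)%N.

(** A convex pentagon around the origin in each of two complementary planes: the boundary of the
    hull of their union is the join of the two pentagons. *)
Definition points10 : seq (seq int) :=
  [:: [:: 1; 0; 0; 0]; [:: 1; 1; 0; 0]; [:: 0; 1; 0; 0]; [:: -1; 0; 0; 0]; [:: 0; -1; 0; 0];
      [:: 0; 0; 1; 0]; [:: 0; 0; 1; 1]; [:: 0; 0; 0; 1]; [:: 0; 0; -1; 0]; [:: 0; 0; 0; -1]].

(* Rounded from [p_j = (w^j, a w^(3j))], [q_i = (0, - b w^(3i))] in C^2, where
   [w = exp(2 pi i / 9)] and [a], [b] are suitable positive constants. *)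
Definition points12 : seq (seq int) :=
  [:: [:: 1; 0; 1; 0]; [:: 1; 1; 0; 1]; [:: 0; 1; -1; -1]; [:: -1; 1; 1; 0];
      [:: -1; 0; 0; 1]; [:: -1; 0; -1; -1]; [:: -1; -1; 1; 0]; [:: 0; -1; 0; 1];
      [:: 1; -1; -1; -1]; [:: 0; 0; -1; 0]; [:: 0; 0; 0; -1]; [:: 0; 0; 1; 1]].

Definition tetrahedra (adj : rel nat) n := [seq c <- cliques adj (iota 0 n) | size c == 4%N].

Section Numbering.
Variables (W : finType) (e : rel W) (n : nat) (adj : rel nat).
Variables (num : W -> nat) (w : nat -> W).
Hypothesis num_lt : forall x, (num x < n)%N.
Hypothesis numK : cancel num w.
Hypothesis wK : forall i, (i < n)%N -> num (w i) = i.
Hypothesis e_sym : symmetric e.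
Hypothesis adjE : forall x y, (x != y) && e x y = adj (num x) (num y).
Notation T0 := (flag_complex e).

Lemma adjacent_num i j : (i < n)%N -> (j < n)%N -> adjacent T0 (w i) (w j) = adj i j.
Proof. by move=> ni nj; rewrite adjacent_flag_complex // adjE !wK. Qed.

Lemma numbered_uniq : uniq (map w (iota 0 n)).
Proof.
rewrite map_inj_in_uniq ?iota_uniq // => i j; rewrite !mem_iota /= !add0n => ni nj.
by move/(congr1 num); rewrite !wK.
Qed.

Lemma numbered_mem x : x \in map w (iota 0 n).
Proof. by rewrite -(numK x) map_f // mem_iota /= add0n num_lt. Qed.

Lemma cliques_num : cliques (adjacent T0) (map w (iota 0 n)) =
  map (map w) (cliques adj (iota 0 n)).
Proof.
apply: cliques_map => i j; rewrite !mem_iota /= !add0n; exact: adjacent_num.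
Qed.

Lemma simplex_num s : s \in T0 -> exists2 c, c \in cliques adj (iota 0 n) &
  s = [set x in map w c]%SET.
Proof.
have Tc := flag_complex_is_complex e; have Tf := @flag_complex_is_flag _ e.
rewrite -mem_enum -(perm_mem (perm_cliques Tc Tf numbered_uniq numbered_mem)).
case/mapP => d; rewrite cliques_num => /mapP[c cC ->] ->; by exists c.
Qed.

Section Polytope.
Variables (R : realType) (pts : seq (seq int)) (facets : seq (seq nat)).
Hypothesis ok : polytope_ok adj n pts facets.

Definition facet (i : 'I_(size facets)) : seq nat := nth [::] facets i.
Definition facet_set (i : 'I_(size facets)) : {set W} := [set x | num x \in facet i].
Definition facet_dual (i : 'I_(size facets)) := cramer (facet_points pts (facet i)).
Definition facet_det (i : 'I_(size facets)) : int := `|laplace 4 (facet_points pts (facet i))|.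
Definition point (x : W) : 'rV[R]_4 := \row_c ((nth [::] pts (num x))`_c)%:~R.
Definition functional (i : 'I_(size facets)) (x : W) : 'cV[R]_4 :=
  \col_c (((nth [::] (facet_dual i) (index (num x) (facet i)))`_c)%:~R / (facet_det i)%:~R).

Lemma facet_okP i : facet_ok adj n pts facets (facet i).
Proof. by case/and5P: ok => _ _ _ /allP + _; apply; exact: mem_nth. Qed.

Lemma size_point j : (j < n)%N -> size (nth [::] pts j) = 4%N.
Proof.
case/and5P: ok => /allP p4 /eqP sp _ _ _ jn; apply/eqP/p4; by rewrite mem_nth ?sp.
Qed.

Lemma size_cramer M a : (a < 4)%N -> size (nth [::] (cramer M) a) = 4%N.
Proof. by move=> a4; rewrite nth_mkseq // size_mkseq. Qed.

Lemma intr_dot (u v : seq int) : size u = 4%N -> size v = 4%N ->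
  (dot u v)%:~R = \sum_(c < 4) (u`_c)%:~R * (v`_c)%:~R :> R.
Proof.
by move=> su sv; rewrite (dotE su sv) rmorph_sum; apply: eq_bigr => c _; rewrite rmorphM.
Qed.

Lemma facet_lt i (a : 'I_4) : (nth 0 (facet i) a < n)%N.
Proof.
case/and5P: (facet_okP i) => /eqP F4 _ /allP Fn _ _.
by apply: Fn; rewrite mem_nth // F4.
Qed.

Lemma nth_facet_points i (a : 'I_4) :
  nth [::] (facet_points pts (facet i)) a = nth [::] pts (nth 0%N (facet i) a).
Proof.
case/and5P: (facet_okP i) => /eqP F4 _ _ _ _.
by rewrite (nth_map 0%N) // F4.
Qed.

Lemma big_facet i (H : W -> R) :
  \sum_(x in facet_set i) H x = \sum_(a < 4) H (w (nth 0%N (facet i) a)).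
Proof.
case/and5P: (facet_okP i) => /eqP F4 uF /allP Fn _ _.
have sF (a : 'I_4) : (a < size (facet i))%N by rewrite F4.
have iF x : x \in facet_set i -> (index (num x) (facet i) < 4)%N.
  by rewrite inE -index_mem F4.
rewrite (reindex_onto (fun a : 'I_4 => w (nth 0%N (facet i) a))
  (fun x => inord (index (num x) (facet i)))) => [|x xF].
  apply: eq_bigl => a; rewrite inE wK ?facet_lt // mem_nth //=.
  by apply/eqP/val_inj; rewrite /= index_uniq // inordK.
by rewrite inordK ?iF // nth_index ?numK //; move: xF; rewrite inE.
Qed.

Lemma pairing_functional i (a : 'I_4) (y : 'rV[R]_4) :
  pairing (functional i (w (nth 0%N (facet i) a))) y =
  (\sum_(c < 4) ((nth [::] (facet_dual i) a)`_c)%:~R * y 0 c) / (facet_det i)%:~R.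
Proof.
case/and5P: (facet_okP i) => /eqP F4 uF _ _ _.
rewrite /pairing mxE mulr_suml; apply: eq_bigr => c _.
by rewrite mxE wK ?facet_lt // index_uniq ?F4 //; ring.
Qed.

Lemma facet_det_gt0 i : 0 < (facet_det i)%:~R :> R.
Proof. by case/and5P: (facet_okP i) => _ _ _ _ /andP[D0 _]; rewrite ltr0z. Qed.

Lemma facet_setP i x : x \in facet_set i -> exists a : 'I_4, x = w (nth 0%N (facet i) a).
Proof.
case/and5P: (facet_okP i) => /eqP F4 _ _ _ _; rewrite inE => xF.
have a4 : (index (num x) (facet i) < 4)%N by rewrite -F4 index_mem.
by exists (Ordinal a4); rewrite /= nth_index.
Qed.

Lemma point_num j c : (j < n)%N -> point (w j) 0 c = ((nth [::] pts j)`_c)%:~R.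
Proof. by move=> jn; rewrite mxE wK. Qed.

Lemma height_point i x : height facet_set functional i (point x) =
  (foldr (fun u s => dot u (nth [::] pts (num x)) + s) 0 (facet_dual i))%:~R /
  (facet_det i)%:~R.
Proof.
rewrite /height big_facet.
under eq_bigr do rewrite pairing_functional.
rewrite -mulr_suml; congr (_ / _).
transitivity (\sum_(a < 4) (dot (nth [::] (facet_dual i) a) (nth [::] pts (num x)))%:~R : R).
  apply: eq_bigr => a _; rewrite intr_dot ?size_cramer ?size_point //.
  by apply: eq_bigr => c _; rewrite mxE.
rewrite -rmorph_sum; congr intr.
rewrite /facet_dual /cramer /mkseq /= !big_ord_recl big_ord0.
by [].
Qed.

Lemma polytope_triangulation : sphere_triangulation R 3 T0.
Proof.
have Tc := flag_complex_is_complex e; split=> //.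
case/and5P: (ok) => _ _ f0 _ /allP cover.
have iota4 (a : 'I_4) : (a : nat) \in iota 0 4 by rewrite mem_iota ltn_ord.
have det0 i : (facet_det i)%:~R != 0 :> R by rewrite gt_eqF // facet_det_gt0.
apply: (@polytope_sphere R W 'I_(size facets) T0 3 facet_set (Ordinal f0) point functional).
- exact: Tc.
- move=> s; apply/idP/existsP => [/simplex_num[c cC ->]|[i si]].
    have cn j : j \in c -> (j < n)%N.
      move: cC; rewrite mem_cliques => /andP[/mem_subseq cn _] /cn.
      by rewrite mem_iota.
    have /(has_nthP [::])[k kf /allP cF] := cover c cC.
    exists (Ordinal kf); apply/fintype.subsetP => x; rewrite !inE => /mapP[j jc ->].
    by rewrite wK ?cn //; exact: cF.
  case/and5P: (facet_okP i) => _ _ _ /allP Fadj _.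
  have [_ _ Tsub] := Tc; apply: Tsub si; apply/flag_complexP => x y; rewrite !inE.
  move=> /Fadj/allP xF /xF /orP[/eqP/(can_inj numK)->|]; first by rewrite eqxx.
  by rewrite -adjE => /andP[].
- move=> i x y /facet_setP[a ->] /facet_setP[b ->].
  case/and5P: (facet_okP i) => /eqP F4 uF _ _ /and5P[_ /allP dualF _ _ _].
  rewrite pairing_functional; under eq_bigr do rewrite point_num ?facet_lt //.
  have /eqP := allP (dualF _ (iota4 a)) _ (iota4 b).
  rewrite -/(facet_dual i) -/(facet_det i) nth_facet_points => dE.
  rewrite -intr_dot ?size_cramer ?size_point ?facet_lt // dE.
  rewrite (can_in_eq (D := fun j => (j < n)%N) wK) ?unfold_in ?facet_lt //.
  by rewrite nth_uniq ?F4 // rmorphMn /= mulrnAl divff.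
- move=> i y; apply/rowP => d.
  case/and5P: (facet_okP i) => /eqP F4 uF _ _ /and5P[_ _ /allP basisF _ _].
  rewrite summxE big_facet.
  under eq_bigr do rewrite mxE pairing_functional point_num ?facet_lt //.
  transitivity (\sum_(c < 4) y 0 c * ((\sum_(a < 4) ((nth [::] (facet_dual i) a)`_c)%:~R *
      ((nth [::] pts (nth 0%N (facet i) a))`_d)%:~R) / (facet_det i)%:~R)).
    under eq_bigr do rewrite mulr_suml mulr_suml.
    rewrite exchange_big; apply: eq_bigr => c _ /=.
    by rewrite mulr_suml mulr_sumr; apply: eq_bigr => a _; ring.
  have basisE (c : 'I_4) : \sum_(a < 4) ((nth [::] (facet_dual i) a)`_c)%:~R *
      ((nth [::] pts (nth 0%N (facet i) a))`_d)%:~R = (facet_det i)%:~R *+ (c == d) :> R.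
    have /eqP := allP (basisF _ (iota4 c)) _ (iota4 d).
    rewrite -/(facet_dual i) -/(facet_det i) => dE.
    transitivity ((facet_det i *+ (c == d))%:~R : R); last by case: (c == d).
    rewrite -dE intr_dot ?size_map ?size_mkseq // ?F4 //.
    apply: eq_bigr => a _; rewrite !nth_column ?size_mkseq ?size_map ?F4 //.
    by rewrite nth_facet_points.
  under eq_bigr do rewrite basisE.
  rewrite (bigD1 d) //= [X in _ + X]big1 ?addr0 => [|c /negPf->]; last by rewrite mul0r mulr0.
  by rewrite eqxx mulr1n divff ?mulr1.
- move=> i x xF; rewrite height_point ltr_pdivrMr ?facet_det_gt0 // mul1r ltr_int.
  case/and5P: (facet_okP i) => _ _ _ _ /and5P[_ _ _ /allP convF _].
  have xn : num x \in iota 0 n by rewrite mem_iota num_lt.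
  by case/orP: (convF _ xn) => // xF'; case/negP: xF; rewrite inE.
- move=> i x xF.
  case/and5P: (facet_okP i) => _ _ _ _ /and5P[_ _ _ _ /allP ridgeF].
  have := ridgeF (num x); rewrite inE in xF => /(_ xF)/(has_nthP [::])[k kf /andP[/allP Fk xk]].
  exists (Ordinal kf); last by rewrite inE.
  apply/fintype.subsetP => y; rewrite !inE => /andP[yx /Fk/orP[/eqP/(can_inj numK) E|//]].
  by rewrite E eqxx in yx.
Qed.

End Polytope.

Lemma euler_char_num : let f k := count (fun c => size c == k) (cliques adj (iota 0 n)) in
  all (fun c => size c <= 4)%N (cliques adj (iota 0 n)) -> (4 <= n)%N ->
  (16 + 4 * f 2 + f 4 != 8 * n + 2 * f 3)%N ->
  euler_char (davis_manifold T0) != 0.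
Proof.
move=> f /allP C4 n4.
have Wn : #|W| = n.
  rewrite -(size_iota 0 n) -(size_map w) -(card_uniqP numbered_uniq).
  by apply: eq_card => x; rewrite numbered_mem.
have fE k : nclique (adjacent T0) (map w (iota 0 n)) k = f k.
  rewrite /nclique cliques_num count_map; apply: eq_count => c /=.
  by rewrite size_map.
rewrite (euler_char_cliques (flag_complex_is_complex e) (@flag_complex_is_flag _ e)
  numbered_uniq numbered_mem) ?Wn // ?fE ?size_map ?size_iota //.
move=> s /simplex_num[c /C4 c4 ->]; apply: leq_trans c4.
by rewrite cardsE -(size_map w) card_size.
Qed.

End Numbering.

Definition num10 (x : 'Z_5 + 'Z_5) : nat :=
  match x with inl j => j | inr j => 5 + j end.
Definition vertex10 (i : nat) : 'Z_5 + 'Z_5 :=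
  if (i < 5)%N then inl (inord i) else inr (inord (i - 5)).
Definition num12 (x : 'Z_9 + 'Z_3) : nat :=
  match x with inl j => j | inr i => 9 + i end.
Definition vertex12 (i : nat) : 'Z_9 + 'Z_3 :=
  if (i < 9)%N then inl (inord i) else inr (inord (i - 9)).

Lemma num10_lt x : (num10 x < 10)%N.
Proof. by case: x => j /=; rewrite ?ltn_add2l; have := ltn_ord j => /leq_trans; apply. Qed.

Lemma num12_lt x : (num12 x < 12)%N.
Proof.
case: x => j /=; first by have := ltn_ord j => /leq_trans; apply.
by rewrite -[12%N]/(9 + 3)%N ltn_add2l; exact: ltn_ord j.
Qed.

Lemma num10K : cancel num10 vertex10.
Proof.
case=> j; rewrite /vertex10 [num10 _]/=; first by rewrite (ltn_ord j : (j < 5)%N) inord_val.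
have -> : (5 + j < 5)%N = false by rewrite ltnNge leq_addr.
by rewrite addKn inord_val.
Qed.

Lemma num12K : cancel num12 vertex12.
Proof.
case=> j; rewrite /vertex12 [num12 _]/=; first by rewrite (ltn_ord j : (j < 9)%N) inord_val.
have -> : (9 + j < 9)%N = false by rewrite ltnNge leq_addr.
by rewrite addKn inord_val.
Qed.

Lemma vertex10K i : (i < 10)%N -> num10 (vertex10 i) = i.
Proof.
move=> i10; rewrite /vertex10; case: ltnP => i5 /=; first by rewrite inordK.
by rewrite inordK ?subnKC // ltn_subLR.
Qed.

Lemma vertex12K i : (i < 12)%N -> num12 (vertex12 i) = i.
Proof.
move=> i12; rewrite /vertex12; case: ltnP => i9 /=; first by rewrite inordK.
by rewrite inordK ?subnKC // ltn_subLR.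
Qed.

Definition graph_ok (adj : rel nat) n := all (fun i => ~~ adj i i &&
  all (fun j => adj i j == adj j i) (iota 0 n)) (iota 0 n).

Section Numbered.
Variables (W : finType) (n : nat) (adj : rel nat) (num : W -> nat) (w : nat -> W).
Hypothesis num_lt : forall x, (num x < n)%N.
Hypothesis numK : cancel num w.
Hypothesis ok : graph_ok adj n.

(** Both complexes are brought to this form, so that all checks become computations with natural
    numbers. *)
Definition numbered_adj : rel W := fun x y => adj (num x) (num y).

Lemma numbered_adj_sym : symmetric numbered_adj.
Proof.
move=> x y; have xn : num x \in iota 0 n by rewrite mem_iota num_lt.
have yn : num y \in iota 0 n by rewrite mem_iota num_lt.
by have /andP[_ /allP/(_ _ yn)/eqP] := allP ok _ xn.
Qed.

Lemma numbered_adjE x y : (x != y) && numbered_adj x y = adj (num x) (num y).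
Proof.
have xn : num x \in iota 0 n by rewrite mem_iota num_lt.
have /andP[xx _] := allP ok _ xn.
by case: eqVneq => [<-|//]; rewrite (negbTE xx).
Qed.
End Numbered.

Lemma flag_complex_ext (V : finType) (e e' : rel V) :
  (forall x y, e x y = e' x y) -> flag_complex e = flag_complex e'.
Proof.
move=> ee'; apply/setP => s; apply/flag_complexP/flag_complexP => sP x y xs ys xy.
  by rewrite -ee'; exact: sP.
by rewrite ee'; exact: sP.
Qed.

Lemma T12E : T12 = flag_complex (numbered_adj adj12 num12).
Proof.
apply: flag_complex_ext => -[j|i] [k|l] //=; rewrite /numbered_adj /adj12.
- by case: j => [[|[|[|[|[|[|[|[|[|//]]]]]]]]] ?]; case: k => [[|[|[|[|[|[|[|[|[|//]]]]]]]]] ?].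
- by case: j => [[|[|[|[|[|[|[|[|[|//]]]]]]]]] ?]; case: l => [[|[|[|//]]] ?].
- by case: k => [[|[|[|[|[|[|[|[|[|//]]]]]]]]] ?]; case: i => [[|[|[|//]]] ?].
Qed.

(** A pentagon has no triangles: besides x, a clique contains at most one of x + 1 and x - 1, which
    are not adjacent. *)
Lemma pentagonP (s : {set 'Z_5}) :
  reflect (forall x y : 'Z_5, x \in s -> y \in s -> x != y -> adj10 x y) (s \in pentagon).
Proof.
have adjE (x y : 'Z_5) : adj10 x y = (y == x + 1) || (x == y + 1).
  by case: x => [[|[|[|[|[|//]]]]] ?]; case: y => [[|[|[|[|[|//]]]]] ?].
rewrite inE; apply: (iffP existsP) => [[i /fintype.subsetP si] x y /si + /si|sP].
  by rewrite !inE adjE => /orP[]/eqP-> /orP[]/eqP->; rewrite ?eqxx ?orbT.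
have [->|[x xs]] := set_0Vmem s; first by exists 0; exact: finset.sub0set.
have near y : y \in s -> [|| y == x, y == x + 1 | x == y + 1].
  by move=> ys; have [//|yx] := eqVneq y x; rewrite -adjE sP // eq_sym.
have [x1|x1] := boolP (x + 1 \in s).
  exists x; apply/fintype.subsetP => y ys; rewrite !inE.
  case/or3P: (near y ys) => [->//|->|/eqP xy]; first by rewrite orbT.
  have /negP[] : ~~ adj10 ((x + 1)%R : 'Z_5) y.
    by rewrite xy; case: y {ys xy} => [[|[|[|[|[|//]]]]] ?].
  apply: sP => //; rewrite xy.
  by case: y {ys xy} => [[|[|[|[|[|//]]]]] ?].
exists (x - 1); apply/fintype.subsetP => y ys; rewrite !inE subrK.
case/or3P: (near y ys) => [->|/eqP yx|/eqP->]; first by rewrite orbT.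
  by rewrite -yx ys in x1.
by rewrite addrK eqxx.
Qed.

Lemma T10E : T10 = flag_complex (numbered_adj adj10 num10).
Proof.
have cross (x y : 'Z_5) : adj10 x (5 + y) && adj10 (5 + x) y.
  by case: x => [[|[|[|[|[|//]]]]] ?]; case: y => [[|[|[|[|[|//]]]]] ?].
have right (x y : 'Z_5) : adj10 (5 + x) (5 + y) = adj10 x y.
  by case: x => [[|[|[|[|[|//]]]]] ?]; case: y => [[|[|[|[|[|//]]]]] ?].
have inlP (s t : {set 'Z_5}) x : (inl x \in inl @: s :|: inr @: t)%SET = (x \in s).
  rewrite inE mem_imset; last by move=> ? ? [].
  by case: (x \in s) => //=; apply/imsetP => -[].
have inrP (s t : {set 'Z_5}) x : (inr x \in inl @: s :|: inr @: t)%SET = (x \in t).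
  rewrite inE orbC mem_imset; last by move=> ? ? [].
  by case: (x \in t) => //=; apply/imsetP => -[].
apply/setP => u; apply/imset2P/flag_complexP => [[s t /pentagonP sP /pentagonP tP ->]|uP].
  move=> [x|x] [y|y]; rewrite ?inlP ?inrP => xs ys xy.
  - by apply: sP => //; apply: contraNneq xy => ->.
  - by have /andP[] := cross x y.
  - by have /andP[] := cross x y.
  - by rewrite /numbered_adj /= right; apply: tP => //; apply: contraNneq xy => ->.
exists [set x | inl x \in u]%SET [set x | inr x \in u]%SET.
- apply/pentagonP => x y; rewrite !inE => xu yu xy; apply: (uP _ _ xu yu).
  by apply: contraNneq xy => -[->].
- apply/pentagonP => x y; rewrite !inE => xu yu xy; rewrite -right; apply: (uP _ _ xu yu).
  by apply: contraNneq xy => -[->].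
by apply/setP => -[x|x]; rewrite ?inlP ?inrP inE.
Qed.

Lemma graph10_ok : graph_ok adj10 10. Proof. by vm_compute. Qed.
Lemma graph12_ok : graph_ok adj12 12. Proof. by vm_compute. Qed.

Lemma polytope10_ok : polytope_ok adj10 10 points10 (tetrahedra adj10 10).
Proof. by vm_compute. Qed.

Lemma polytope12_ok : polytope_ok adj12 12 points12 (tetrahedra adj12 12).
Proof. by vm_compute. Qed.

Lemma search10_ok : search 10 (backs adj10 10) [::] [::].
Proof. by vm_compute. Qed.

Lemma search12_ok : search 12 (backs adj12 12) [::] [::].
Proof. by vm_compute. Qed.

Theorem proposition1p6 (R : realType) :
  [/\ ~ complex_iso T10 T12,
      sphere_triangulation R 3 T10 /\ sphere_triangulation R 3 T12,
      is_flag T10 /\ is_flag T12,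
      euler_char (davis_manifold T10) != 0 /\
        euler_char (davis_manifold T12) != 0
    & forall (V : finType) (T : {set {set V}}),
        sphere_triangulation R 3 T ->
        is_flag T ->
        euler_char (davis_manifold T) != 0 ->
        (~ complex_iso T T10 -> ~ dominates 3 T10 T) /\
        (~ complex_iso T T12 -> ~ dominates 3 T12 T)].
Proof.
have sym10 := @numbered_adj_sym _ _ _ _ num10_lt graph10_ok.
have sym12 := @numbered_adj_sym _ _ _ _ num12_lt graph12_ok.
have adj10E := @numbered_adjE _ _ _ _ num10_lt graph10_ok.
have adj12E := @numbered_adjE _ _ _ _ num12_lt graph12_ok.
split.
- move=> [f fb _]; have := bij_eq_card fb.
  by rewrite !card_sum !card_ord.
- rewrite T10E T12E; split.
    exact: (polytope_triangulation num10_lt num10K vertex10K sym10 adj10E R polytope10_ok).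
  exact: (polytope_triangulation num12_lt num12K vertex12K sym12 adj12E R polytope12_ok).
- by rewrite T10E T12E; split; exact: flag_complex_is_flag.
(* The face numbers (f_0, f_1, f_2, f_3) are (10, 35, 50, 25) and (12, 45, 66, 33); in both cases 16
   - 8 f_0 + 4 f_1 - 2 f_2 + f_3 = 1. *)
- rewrite T10E T12E; split.
    by apply: (euler_char_num num10_lt num10K vertex10K sym10 adj10E); vm_compute.
  by apply: (euler_char_num num12_lt num12K vertex12K sym12 adj12E); vm_compute.
move=> V T Ts Tf chi; split=> niso dom; apply: niso; move: dom; rewrite ?T10E ?T12E => dom.
- apply: (dominates_iso (flag_complex_is_complex _)
    (adjacent_num vertex10K sym10 adj10E) _ search10_ok Ts Tf chi dom).
  by move=> x; exists (num10 x); [exact: num10_lt|exact: num10K].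
- apply: (dominates_iso (flag_complex_is_complex _)
    (adjacent_num vertex12K sym12 adj12E) _ search12_ok Ts Tf chi dom).
  by move=> x; exists (num12 x); [exact: num12_lt|exact: num12K].
Qed.
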